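(* Let $M$ be a smooth compact Riemannian manifold without boundary. Let $\{f_i\}_{i=1}^\infty$ be a countable set of $C^{1+\theta}$-expanding endomorphisms of $M$ which are conformal on $M$ (i.e., for each $i$ and each $x\in M$, the derivative map $D_xf_i$ is a scalar multiple of an isometry), and let $Y$ be a countable subset of $M$. Then $\bigcap_{i=1}^\infty E(f_i,Y)$ is absolute winning, where $$E(f,Y)=\{z\in M: Y\cap\overline{\{f^k(z): k\in\mathbb{N}\}}=\emptyset\}.$$
   Context: Here $\mathbb{N}=\{0,1,2,\dots\}$. A $C^{1+\theta}$-expanding endomorphism ($\theta>0$) is a $C^1$ map $f:M\to M$ with $\theta$-Hölder derivative for which there are constants $1<\sigma_1\le\sigma_2$ (depending on $f$) with $\sigma_1\|v\|\le\|D_xf v\|\le\sigma_2\|v\|$ for all $x\in M$, $v\in T_xM$. Absolute game on $\mathbb{R}^d$: fix $0<\beta<1/3$ and a target set $S\subset\mathbb{R}^d$. Bob initially chooses a closed ball $B_1=B(x_1,\rho_1)$, $\rho_1>0$. In each turn, after Bob has chosen a closed ball $B_i=B(x_i,\rho_i)$, Alice chooses a point $L_i\in\mathbb{R}^d$ (a $0$-dimensional affine subspace) and removes its $\epsilon_i$-neighborhood $L_i^{(\epsilon_i)}$ from $B_i$, for some $0<\epsilon_i\le\beta\rho_i$; then Bob chooses a closed ball $B_{i+1}\subset B_i\setminus L_i^{(\epsilon_i)}$ of radius $\rho_{i+1}\ge\beta\rho_i$. Alice wins if and only if $\bigcap_{i=1}^\infty B_i\cap S\ne\emptyset$. $S$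 is ($0$-dimensionally) $\beta$-absolute winning if Alice has a winning strategy, and absolute winning if it is $\beta$-absolute winning for every $0<\beta<1/3$. Absolute winning on a manifold: for $U\subset\mathbb{R}^d$ open, a set $S\subset U$ is absolute winning on $U$ if, for every $0<\beta<1/3$, Alice has a winning strategy in the absolute game on $\mathbb{R}^d$ with parameter $\beta$ and target set $S$ when Bob is required to choose $B_1\subset U$. A subset $S$ of a $d$-dimensional manifold $M$ is absolute winning if there is a collection of coordinate charts $(U_i,\varphi_i)$ covering $M$ such that $\varphi_i(S\cap U_i)$ is absolute winning on $\varphi_i(U_i)$ for every $i$ (this does not depend on the choice of charts, by invariance of absolute winning under $C^1$ diffeomorphisms). *)

(* Defs.v *)
From HB Require Import structures.
From mathcomp Require Import all_boot all_order all_algebra.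
From mathcomp Require Import all_classical all_reals all_analysis.

Set Implicit Arguments.
Unset Strict Implicit.
Unset Printing Implicit Defensive.

Import Order.TTheory GRing.Theory Num.Theory.
Import numFieldNormedType.Exports.

Local Open Scope classical_set_scope.
Local Open Scope ring_scope.

(* [U] is meant to be open. *)
Fixpoint Ck_on (R : realType) (V W : normedModType R) (k : nat) (U : set V)
    (F : V -> W) : Prop :=
  match k with
  | 0 => forall x, U x -> {for x, continuous F}
  | k'.+1 => (forall x, U x -> differentiable F x) /\
             forall v, Ck_on k' U (fun x => 'd F x v)
  end.

Definition smooth_on (R : realType) (V W : normedModType R) (U : set V)
  (F : V -> W) : Prop := forall k, Ck_on k U F.

(* A chart is a homeomorphism from an open set [dom] of M onto an open set of
   R^d.  Both [coord] and [inv] are total functions whose values off [dom] and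
   off [coord @` dom], respectively, are irrelevant. *)
Record chart (R : realType) (d : nat) (M : topologicalType) := Chart {
  dom : set M ;
  coord : M -> 'rV[R]_d ;
  inv : 'rV[R]_d -> M ;
  dom_open : open dom ;
  cod_open : open (coord @` dom) ;
  coordK : forall p, dom p -> inv (coord p) = p ;
  coord_continuous : forall p, dom p -> {for p, continuous coord} ;
  inv_continuous : forall x, (coord @` dom) x -> {for x, continuous inv}
}.

Section Manifolds.
Context {R : realType} {d : nat} {M : topologicalType}.
Implicit Types (c : chart R d M) (f : M -> M).

Definition cod c : set 'rV[R]_d := coord c @` dom c.

(* The expression of f in the charts c (source) and c' (target), and the open
   set on which it is meaningful.  With f = id this is the change of
   coordinates from c to c'. *)
Definition local_rep f c c' : 'rV[R]_d -> 'rV[R]_d :=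
  fun x => coord c' (f (inv c x)).

Definition rep_dom f c c' : set 'rV[R]_d :=
  coord c @` (dom c `&` f @^-1` dom c').

Definition smoothly_compatible c c' : Prop :=
  smooth_on (rep_dom id c c') (local_rep id c c') /\
  smooth_on (rep_dom id c' c) (local_rep id c' c).

End Manifolds.

(* The smooth structure is given by a maximal atlas; charts take values in
   open subsets of R^d, so there is no boundary. *)
Record smooth_manifold (R : realType) (d : nat) (M : topologicalType) :=
  SmoothManifold {
  atlas : set (chart R d M) ;
  manifold_hausdorff : hausdorff_space M ;
  manifold_second_countable : @second_countable M ;
  atlas_cover : forall p : M, exists2 c, atlas c & dom c p ;
  atlas_compatible : forall c c', atlas c -> atlas c' ->
    smoothly_compatible c c' ;
  atlas_maximal : forall c,
    (forall c', atlas c' -> smoothly_compatible c c') -> atlas c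
}.

Definition gram_form (R : realType) (d : nat) (G : 'M[R]_d) (u v : 'rV[R]_d)
  : R := (u *m G *m v^T) 0 0.

(* The tangent space at p is represented, in each chart c around p, by 'rV_d;
   the representatives of a vector in c and c' correspond under the
   differential of the change of coordinates.  [gram c x] is the matrix of the
   metric in the chart c at the point with coordinates x. *)
Record riemannian_metric (R : realType) (d : nat) (M : topologicalType)
    (X : smooth_manifold R d M) := RiemannianMetric {
  gram : chart R d M -> 'rV[R]_d -> 'M[R]_d ;
  gram_smooth : forall c, atlas X c -> smooth_on (cod c) (gram c) ;
  gram_sym : forall c x, atlas X c -> cod c x -> (gram c x)^T = gram c x ;
  gram_pos : forall c x v, atlas X c -> cod c x -> v != 0 ->
    0 < gram_form (gram c x) v v ;
  gram_compat : forall c c' x u v, atlas X c -> atlas X c' ->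
    rep_dom id c c' x ->
    gram_form (gram c' (local_rep id c c' x))
      ('d (local_rep id c c') x u) ('d (local_rep id c c') x v)
    = gram_form (gram c x) u v
}.

Section Endomorphisms.
Context {R : realType} {d : nat} {M : topologicalType}.
Context {X : smooth_manifold R d M}.
Implicit Types (g : riemannian_metric X) (f : M -> M).

(* Norm of the tangent vector with components v in the chart c at the point
   with coordinates x. *)
Definition tnorm g (c : chart R d M) (x v : 'rV[R]_d) : R :=
  Num.sqrt (gram_form (gram g c x) v v).

(* C^1 with theta-Hoelder derivative.  The Hoelder condition is required
   locally in charts, where any norms on R^d may be used; on a compact
   manifold a local condition is also a uniform one. *)
Definition C1_holder (X' : smooth_manifold R d M) (theta : R) f : Prop :=
  continuous f /\
  forall c c', atlas X' c -> atlas X' c' ->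
    let F := local_rep f c c' in
    Ck_on 1 (rep_dom f c c') F /\
    forall x, rep_dom f c c' x ->
      exists C : R, \forall y & z \near x, forall v : 'rV[R]_d,
        `| 'd F y v - 'd F z v | <= C * (`|y - z| `^ theta) * `|v|.

Definition expanding g f : Prop :=
  exists sigma1 sigma2 : R, [/\ 1 < sigma1, sigma1 <= sigma2 &
    forall c c' x v, atlas X c -> atlas X c' -> rep_dom f c c' x ->
      let F := local_rep f c c' in
      sigma1 * tnorm g c x v <= tnorm g c' (F x) ('d F x v) /\
      tnorm g c' (F x) ('d F x v) <= sigma2 * tnorm g c x v].

Definition expanding_endomorphism g (theta : R) f : Prop :=
  C1_holder X theta f /\ expanding g f.

Definition conformal g f : Prop :=
  forall c c' x, atlas X c -> atlas X c' -> rep_dom f c c' x ->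
    let F := local_rep f c c' in
    exists (a : R) (A : {linear 'rV[R]_d -> 'rV[R]_d}),
      (forall v, tnorm g c' (F x) (A v) = tnorm g c x v) /\
      (forall v, 'd F x v = a *: A v).

End Endomorphisms.

Definition E_set (M : topologicalType) (f : M -> M) (Y : set M) : set M :=
  [set z | Y `&` closure (range (fun k : nat => iter k f z)) = set0].

Section AbsoluteGame.
Context {R : realType} {d : nat}.

(* The library norm on 'rV_d is the sup norm; the game is played with
   Euclidean balls. *)
Definition euclid_norm (v : 'rV[R]_d) : R := Num.sqrt (\sum_i v 0 i ^+ 2).

Definition cball (B : 'rV[R]_d * R) : set 'rV[R]_d :=
  [set y | euclid_norm (y - B.1) <= B.2].

Definition point_nbhd (L : 'rV[R]_d * R) : set 'rV[R]_d :=
  [set y | euclid_norm (y - L.1) < L.2].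

(* Given the nonempty list of the balls (center, radius) chosen so far by Bob,
   a strategy returns the pair (L_i, epsilon_i). *)
Definition alice_strategy := seq ('rV[R]_d * R) -> 'rV[R]_d * R.

Definition legal_strategy (beta : R) (s : alice_strategy) : Prop :=
  forall h B, 0 < B.2 ->
    0 < (s (rcons h B)).2 /\ (s (rcons h B)).2 <= beta * B.2.

(* The sequence b is an infinite legal play of Bob against s, with first ball
   inside U. *)
Definition bob_play (beta : R) (U : set 'rV[R]_d) (s : alice_strategy)
    (b : nat -> 'rV[R]_d * R) : Prop :=
  [/\ 0 < (b 0%N).2, cball (b 0%N) `<=` U &
    forall n, cball (b n.+1) `<=`
                cball (b n) `\` point_nbhd (s (mkseq b n.+1)) /\
              beta * (b n).2 <= (b n.+1).2].

Definition absolute_winning_on (U S : set 'rV[R]_d) : Prop :=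
  forall beta : R, 0 < beta -> beta < 1 / 3 ->
    exists s : alice_strategy, legal_strategy beta s /\
      forall b, bob_play beta U s b ->
        (\bigcap_n cball (b n)) `&` S !=set0.

End AbsoluteGame.

Definition absolute_winning (R : realType) (d : nat) (M : topologicalType)
    (X : smooth_manifold R d M) (S : set M) : Prop :=
  exists C : set (chart R d M),
    [/\ C `<=` atlas X,
        (forall p : M, exists2 c, C c & dom c p) &
        forall c, C c ->
          absolute_winning_on (cod c) (coord c @` (S `&` dom c))].

(* Main.v *)
Require Import Defs.
From HB Require Import structures.
From mathcomp Require Import all_boot all_order all_algebra.
From mathcomp Require Import all_classical all_reals all_analysis.
From mathcomp Require Import ring lra zify.
(* once more, since [coord] also names a function of mathcomp's vector.v *)
Import Defs.

Set Implicit Arguments.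
Unset Strict Implicit.
Unset Printing Implicit Defensive.

Import Order.TTheory GRing.Theory Num.Theory.
Import numFieldNormedType.Exports.

Local Open Scope classical_set_scope.
Local Open Scope ring_scope.

(** Select charts from a finite atlas and let [D p q] be the Riemannian norm at
    [p] of the difference of the coordinates of [q] and [p] in the chart selected
    at [p].  A conformal expanding [C^(1+theta)] map satisfies
    [D (f p) (f q) = a p * D p q * (1 + O(D p q ^ theta))] with [a p >= sigma > 1],
    whence bounded distortion: as long as [L_k p * D p q] is small, where [L_k p]
    is the product of [a] along the first [k] points of the orbit of [p],
    [D (f^k p) (f^k q)] is comparable to [L_k p * D p q].

    To keep the orbit of the limit point away from [y], Alice looks, for the
    current ball of radius [rho], for a point [p] of the ball and a time [k] such
    that [f^k p] is very close to [y] and [rho * L_k p] lies in a window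
    [[beta c, c]].  Two such times differ by a bounded amount, so that if [c] is
    small compared to the distances from [y] to its finitely many relevant
    preimages, all such points [p] lie within [beta rho] of each other and one
    removal deletes all of them.  Every large [k] has its turn, since the radii
    shrink by at most [beta].  The remaining requirement [f^k z <> y] for each [k]
    is met by removing single points, and the countably many games thus obtained
    are interleaved.  A play whose radii do not tend to 0 leaves a whole ball,
    inside which a shrinking play can be continued. *)

(** * Euclidean and Riemannian norms *)

Section GramNorm.
Context {R : realType} {d : nat}.
Implicit Types (G : 'M[R]_d) (u v w : 'rV[R]_d).

Definition gram_norm G v : R := Num.sqrt (gram_form G v v).

Lemma gram_formDl G u v w :
  gram_form G (u + v) w = gram_form G u w + gram_form G v w.
Proof. by rewrite /gram_form !mulmxDl mxE. Qed.

Lemma gram_formDr G u v w :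
  gram_form G u (v + w) = gram_form G u v + gram_form G u w.
Proof. by rewrite /gram_form linearD mulmxDr mxE. Qed.

Lemma gram_formZl G (k : R) u v : gram_form G (k *: u) v = k * gram_form G u v.
Proof. by rewrite /gram_form -!scalemxAl mxE. Qed.

Lemma gram_formZr G (k : R) u v : gram_form G u (k *: v) = k * gram_form G u v.
Proof. by rewrite /gram_form linearZ /= -scalemxAr mxE. Qed.

Lemma gram_form_sym G u v : G^T = G -> gram_form G u v = gram_form G v u.
Proof.
move=> GT; have -> : gram_form G u v = (u *m G *m v^T)^T 0 0 by rewrite mxE.
by rewrite !trmx_mul trmxK GT mulmxA.
Qed.

Lemma gram_normZ G (k : R) v : gram_norm G (k *: v) = `|k| * gram_norm G v.
Proof.
by rewrite /gram_norm gram_formZl gram_formZr mulrA -expr2 sqrtrM ?sqr_ge0//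
  sqrtr_sqr.
Qed.

Lemma gram_norm0 G : gram_norm G 0 = 0.
Proof. by rewrite -(scale0r (0 : 'rV[R]_d)) gram_normZ normr0 mul0r. Qed.

Lemma gram_normN G v : gram_norm G (- v) = gram_norm G v.
Proof. by rewrite -scaleN1r gram_normZ normrN1 mul1r. Qed.

Lemma gram_norm_ge0 G v : 0 <= gram_norm G v.
Proof. exact: sqrtr_ge0. Qed.

Lemma gram_norm_gt0 G v : (forall w, w != 0 -> 0 < gram_form G w w) ->
  v != 0 -> 0 < gram_norm G v.
Proof. by move=> Gpos v0; rewrite sqrtr_gt0 Gpos. Qed.

Lemma gram_norm_triangle G u v : G^T = G ->
  (forall w, w != 0 -> 0 < gram_form G w w) ->
  gram_norm G (u + v) <= gram_norm G u + gram_norm G v.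
Proof.
move=> GT Gpos.
have [->|u0] := eqVneq u 0; first by rewrite add0r gram_norm0 add0r.
have [->|v0] := eqVneq v 0; first by rewrite addr0 gram_norm0 addr0.
have ru := gram_norm_gt0 Gpos u0; have rv := gram_norm_gt0 Gpos v0.
have Gge0 w : 0 <= gram_form G w w.
  have [->|/Gpos/ltW//] := eqVneq w 0.
  by rewrite -(scale0r (0 : 'rV[R]_d)) gram_formZl mul0r.
have uu : gram_norm G u ^+ 2 = gram_form G u u by rewrite sqr_sqrtr.
have vv : gram_norm G v ^+ 2 = gram_form G v v by rewrite sqr_sqrtr.
(* Positivity of the form at this vector is Cauchy-Schwarz multiplied by twice the product of the
   two norms. *)
have := Gge0 (gram_norm G v *: u - gram_norm G u *: v).
rewrite gram_formDl !gram_formDr -!scaleNr !gram_formZl !gram_formZr.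
rewrite (gram_form_sym v u GT) // -uu -vv => H.
have : gram_form G u v <= gram_norm G u * gram_norm G v.
  have p : 0 < gram_norm G u * gram_norm G v by rewrite mulr_gt0.
  by rewrite -(ler_pM2l p); nra.
move=> CS.
have -> : gram_norm G u + gram_norm G v =
   Num.sqrt ((gram_norm G u + gram_norm G v) ^+ 2).
  by rewrite sqrtr_sqr ger0_norm // addr_ge0 // ltW.
rewrite ler_wsqrtr // gram_formDl !gram_formDr (gram_form_sym v u GT) //.
by rewrite -uu -vv; nra.
Qed.

Lemma gram_norm_lipschitz G u v : G^T = G ->
  (forall w, w != 0 -> 0 < gram_form G w w) ->
  `|gram_norm G (u + v) - gram_norm G u| <= gram_norm G v.
Proof.
move=> GT Gpos; have H1 := gram_norm_triangle u v GT Gpos.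
have := gram_norm_triangle (u + v) (- v) GT Gpos.
by rewrite addrK gram_normN ler_norml => H2; apply/andP; split; lra.
Qed.

Lemma euclid_normE v : euclid_norm v = gram_norm 1%:M v.
Proof.
rewrite /euclid_norm /gram_norm /gram_form mulmx1 mxE; congr Num.sqrt.
by apply: eq_bigr => i _; rewrite mxE expr2.
Qed.

End GramNorm.

Section EuclidNorm.
Context {R : realType} {d : nat}.
Implicit Types (u v w : 'rV[R]_d).

Lemma coord_le_norm v i : `|v 0 i| <= `|v|.
Proof.
rewrite [`|v|]mx_normrE; apply: (le_trans _ (le_bigmax _ _ (0, i))).
by [].
Qed.

Lemma norm_le_coord v (e : R) : 0 <= e -> (forall i, `|v 0 i| <= e) -> `|v| <= e.
Proof.
move=> e0 H; rewrite [`|v|]mx_normrE; apply/bigmax_leP; split => //= i _.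
by rewrite (ord1 i.1).
Qed.

Lemma gram1_pos w : w != 0 -> 0 < gram_form (1%:M : 'M[R]_d) w w.
Proof.
move=> w0; rewrite /gram_form mulmx1 mxE.
have [i wi] : exists i, w 0 i != 0.
  apply/existsP; rewrite -negb_forall; apply: contra w0 => /forallP H.
  by apply/eqP/rowP => i; rewrite mxE; apply/eqP.
rewrite (bigD1 i) //= mxE -expr2 ltr_pwDl //; first by rewrite exprn_even_gt0.
by apply: sumr_ge0 => j _; rewrite mxE -expr2 sqr_ge0.
Qed.

Lemma euclid_norm_ge0 v : 0 <= euclid_norm v. Proof. exact: sqrtr_ge0. Qed.

Lemma euclid_norm0 : euclid_norm (0 : 'rV[R]_d) = 0.
Proof. by rewrite euclid_normE gram_norm0. Qed.

Lemma euclid_normN v : euclid_norm (- v) = euclid_norm v.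
Proof. by rewrite !euclid_normE gram_normN. Qed.

Lemma euclid_normB u v : euclid_norm (u - v) = euclid_norm (v - u).
Proof. by rewrite -euclid_normN opprB. Qed.

Lemma euclid_normZ (k : R) v : euclid_norm (k *: v) = `|k| * euclid_norm v.
Proof. by rewrite !euclid_normE gram_normZ. Qed.

Lemma euclid_normD u v : euclid_norm (u + v) <= euclid_norm u + euclid_norm v.
Proof.
rewrite !euclid_normE; apply: gram_norm_triangle; first exact: trmx1.
exact: gram1_pos.
Qed.

Lemma norm_le_euclid v : `|v| <= euclid_norm v.
Proof.
apply: norm_le_coord; first exact: euclid_norm_ge0.
move=> i; rewrite -sqrtr_sqr ler_wsqrtr // (bigD1 i) //= lerDl.
by apply: sumr_ge0 => j _; rewrite sqr_ge0.
Qed.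

Lemma euclid_le_norm v : euclid_norm v <= d%:R * `|v|.
Proof.
have -> : d%:R * `|v| = Num.sqrt ((d%:R * `|v|) ^+ 2).
  by rewrite sqrtr_sqr ger0_norm // mulr_ge0.
rewrite ler_wsqrtr // (le_trans (y := d%:R * `|v| ^+ 2)) //.
  have -> : d%:R * `|v| ^+ 2 = \sum_(i < d) `|v| ^+ 2.
    by rewrite sumr_const card_ord mulr_natl.
  apply: ler_sum => i _.
  rewrite -real_normK ?num_real // lerXn2r ?nnegrE //.
  exact: coord_le_norm.
by rewrite exprMn ler_wpM2r ?sqr_ge0 // -natrX ler_nat; nia.
Qed.

Lemma nbhs_dist_leP (V : normedModType R) (x : V) (P : set V) :
  nbhs x P <-> exists2 e : R, 0 < e & forall y, `|y - x| <= e -> P y.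
Proof.
split=> [/nbhs_closedballP [e H]|[e e0 H]].
  exists e%:num => // y yx; apply: H; rewrite closed_ballE // /closed_ball_ /=.
  by rewrite distrC.
apply/nbhs_closedballP; exists (PosNum e0) => y.
by rewrite closed_ballE // /closed_ball_ /= distrC; exact: H.
Qed.

Lemma euclid_dist_continuous (x : 'rV[R]_d) :
  continuous (fun y : 'rV[R]_d => euclid_norm (y - x)).
Proof.
move=> z; apply/(@cvgrPdist_le _ _ _ (nbhs z)) => e e0.
have d0 : (0 : R) < d%:R + 1 by rewrite ltr_wpDl.
apply/(@nbhs_dist_leP 'rV[R]_d z); exists (e / (d%:R + 1)); first by rewrite divr_gt0.
move=> y zy.
have key (a b : 'rV[R]_d) :
    euclid_norm (a - x) <= euclid_norm (b - x) + euclid_norm (a - b).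
  by have := euclid_normD (b - x) (a - b); rewrite addrC addrA subrK.
have bd : euclid_norm (y - z) <= e.
  apply: (le_trans (euclid_le_norm _)).
  rewrite (le_trans (y := (d%:R + 1) * `|y - z|)) // ?ler_wpM2r // ?lerDl//.
  by rewrite mulrC -ler_pdivlMr.
have := key z y; have := key y z; rewrite (euclid_normB z y) => H1 H2.
by rewrite ler_norml; apply/andP; split; lra.
Qed.

End EuclidNorm.

(** * The absolute game *)

Section Game.
Context {R : realType} {d : nat}.
Implicit Types (x y p : 'rV[R]_d) (B : 'rV[R]_d * R) (Q S U : set 'rV[R]_d)
  (b : nat -> 'rV[R]_d * R).

Lemma cball_center B : 0 <= B.2 -> cball B B.1.
Proof. by rewrite /cball /= subrr euclid_norm0. Qed.

Lemma cball_diam B x y : cball B x -> cball B y -> `|x - y| <= 2 * B.2.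
Proof.
rewrite /cball /= => Bx By.
have -> : x - y = (x - B.1) - (y - B.1) by rewrite opprB addrA subrK.
rewrite (le_trans (ler_normB _ _)) //.
have := norm_le_euclid (x - B.1); have := norm_le_euclid (y - B.1).
lra.
Qed.

Lemma cball_closed B : closed (cball B).
Proof.
rewrite /cball; have -> : [set y | euclid_norm (y - B.1) <= B.2] =
   (fun y => euclid_norm (y - B.1)) @^-1` [set r : R | r <= B.2] by [].
apply: preimage_closed; last exact: closed_le.
by move=> x _; exact: euclid_dist_continuous.
Qed.

Lemma cball_compact B : compact (cball B).
Proof.
apply: bounded_closed_compact; last exact: cball_closed.
exists (`|B.1| + B.2); split; first exact: num_real.
move=> e Be x; rewrite /cball /= => Bx.
have := norm_le_euclid (x - B.1); have := ler_distD B.1 x 0.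
by rewrite !subr0; lra.
Qed.

Lemma sub_cball x x' (r r' : R) : euclid_norm (x' - x) + r' <= r ->
  cball (x', r') `<=` cball (x, r).
Proof.
move=> H y; rewrite /cball /= => yx'.
have -> : y - x = (y - x') + (x' - x) by rewrite addrA subrK.
by rewrite (le_trans (euclid_normD _ _)) //; lra.
Qed.

(* Alice always removes the largest neighbourhood that she is allowed to, so
   that a strategy consists of a choice of centers; [s n] is used at turn [n]. *)
Definition play (beta : R) Q (s : nat -> 'rV[R]_d * R -> 'rV[R]_d) b : Prop :=
  [/\ forall n, 0 < (b n).2, cball (b 0%N) `<=` Q,
      forall n, cball (b n.+1) `<=`
        cball (b n) `\` point_nbhd (s n (b n), beta * (b n).2) &
      forall n, beta * (b n).2 <= (b n.+1).2].

Definition shrinking b : Prop :=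
  forall e : R, 0 < e -> exists N, forall n, (N <= n)%N -> (b n).2 <= e.

(* Only shrinking plays matter here: [absolute_winning_onI] deals with the
   others. *)
Definition positional_winning Q S : Prop :=
  forall beta : R, 0 < beta -> beta < 1 ->
    exists s : 'rV[R]_d * R -> 'rV[R]_d,
      forall b, play beta Q (fun=> s) b -> shrinking b ->
        \bigcap_n cball (b n) `<=` S.

Lemma play_nested beta Q s b m n : play beta Q s b -> (m <= n)%N ->
  cball (b n) `<=` cball (b m).
Proof.
move=> [_ _ sub _] /subnK <-; elim: (n - m)%N => [|k IH] //.
by rewrite addSn => x /sub [/IH].
Qed.

Lemma play_ratio beta Q s b m n : 0 < beta -> play beta Q s b ->
  beta ^+ n * (b m).2 <= (b (n + m)%N).2.
Proof.
move=> beta0 [_ _ _ rat]; elim: n => [|n IH]; first by rewrite mul1r.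
by rewrite addSn (le_trans _ (rat _)) // exprS -mulrA ler_pM2l.
Qed.

(** Consecutive turns of game [j] are [2 ^ j.+1] apart, so its balls form a play with parameter
    [beta ^+ (2 ^ j.+1)], and the neighbourhood really removed contains the one that this game asks
    for. *)
Lemma positional_winning_bigcap Q (S : nat -> set 'rV[R]_d) (beta : R) :
  (forall j, positional_winning Q (S j)) -> 0 < beta -> beta < 1 ->
  exists s, forall b, play beta Q s b -> shrinking b ->
    \bigcap_n cball (b n) `<=` \bigcap_j S j.
Proof.
move=> win beta0 beta1.
have bj0 j : 0 < beta ^+ (2 ^ j.+1) by rewrite exprn_gt0.
have bj1 j : beta ^+ (2 ^ j.+1) < 1.
  by rewrite exprn_ilt1 ?(ltW beta0) // expn_eq0.
have /choice [s sP] := fun j => win j _ (bj0 j) (bj1 j).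
(* game [j] is played at the turns [2 ^ j * (2 * m + 1) - 1] *)
exists (fun n => s (logn 2 n.+1)) => b bplay shr x bx j _.
pose k m := (2 ^ j * m.*2.+1).-1.
have kS m : (k m).+1 = (2 ^ j * m.*2.+1)%N.
  by rewrite prednK // muln_gt0 expn_gt0.
have kD m : k m.+1 = (2 ^ j.+1 + k m)%N.
  by apply: succn_inj; rewrite -addnS !kS expnS; lia.
have kge m : (m <= k m)%N.
  rewrite -ltnS kS; have : (0 < 2 ^ j)%N by rewrite expn_gt0.
  by move: (2 ^ j)%N => t; nia.
have kj m : logn 2 (k m).+1 = j.
  by rewrite kS lognM ?expn_gt0 // pfactorK // lognE /= dvdn2 /= odd_double addn0.
apply: (sP j (b \o k)); last by move=> m _; exact: bx.
  have [pos b0 sub rat] := bplay; split => [m|y|m y|m] /=.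
  - exact: pos.
  - by move=> by0; apply: b0; apply: (play_nested bplay (leq0n _) by0).
  - move=> yk; have [|yb yp] := sub (k m) y.
      apply: (play_nested bplay _ yk).
      by rewrite kD -add1n leq_add2r expn_gt0.
    split => //; rewrite kj in yp; apply: contra_not yp.
    rewrite /point_nbhd /= => /lt_le_trans; apply.
    by rewrite ler_pM2r // -[leRHS]expr1 ler_wiXn2l ?ltW // expn_gt0.
  - by rewrite kD; exact: (play_ratio _ _ beta0 bplay).
move=> e /shr [N HN]; exists N => n Nn /=; apply: HN.
exact: leq_trans Nn (kge n).
Qed.

Lemma positional_winning_setT Q : positional_winning Q setT.
Proof. by move=> beta _ _; exists (fun=> 0). Qed.

(** The points [x + w] and [x - w] are [2 (1 - beta) r] apart, so one of them is at least
    [(1 - beta) r] away from [p]; this is at least [2 beta r] because [beta <= 1 / 3]. *)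
Lemma bob_move (beta r : R) x p : (0 < d)%N -> 0 < beta -> beta <= 1 / 3 ->
  0 < r -> exists x', cball (x', beta * r) `<=`
    cball (x, r) `\` point_nbhd (p, beta * r).
Proof.
move=> d0 beta0 beta1 r0.
have [e e1] : exists e : 'rV[R]_d, euclid_norm e = 1.
  exists (delta_mx 0 (Ordinal d0)); rewrite /euclid_norm (bigD1 (Ordinal d0)) //=.
  rewrite mxE !eqxx expr1n big1 ?addr0 ?sqrtr1 // => i ni.
  by rewrite mxE (negPf ni) andbF expr0n.
pose w := ((1 - beta) * r) *: e.
have w0 : euclid_norm w = (1 - beta) * r.
  by rewrite euclid_normZ e1 mulr1 ger0_norm // mulr_ge0; lra.
have far x' : euclid_norm (x' - x) = (1 - beta) * r ->
    (1 - beta) * r <= euclid_norm (x' - p) ->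
    cball (x', beta * r) `<=` cball (x, r) `\` point_nbhd (p, beta * r).
  move=> x'x x'p y yx'; split.
    by apply: sub_cball yx'; rewrite x'x; lra.
  move: yx'; rewrite /cball /point_nbhd /= => yx' yp.
  have := euclid_normD (x' - y) (y - p).
  by rewrite addrA subrK (euclid_normB x' y); nra.
have [H|H] := leP ((1 - beta) * r) (euclid_norm (x + w - p)).
  by exists (x + w); apply: far => //; rewrite (addrC x) addrK.
exists (x - w); apply: far; first by rewrite addrAC subrr add0r euclid_normN.
rewrite leNgt; apply/negP => H'.
have := euclid_normD (x + w - p) (p - (x - w)).
have -> : x + w - p + (p - (x - w)) = 2 *: w.
  by apply/rowP => i; rewrite !mxE; ring.
by rewrite euclid_normZ w0 (euclid_normB p) ger0_norm // ; lra.
Qed.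

Lemma shrinking_play_exists (beta : R) B s : (0 < d)%N -> 0 < beta ->
  beta < 1 / 3 -> 0 < B.2 ->
  exists2 b, play beta (cball B) s b & shrinking b.
Proof.
move=> d0 beta0 beta1 B0.
have [mv mvP] : exists mv : nat -> 'rV[R]_d * R -> 'rV[R]_d,
    forall n C, 0 < C.2 -> cball (mv n C, beta * C.2) `<=`
      cball C `\` point_nbhd (s n C, beta * C.2).
  have H (nC : nat * ('rV[R]_d * R)) : exists x', 0 < nC.2.2 ->
      cball (x', beta * nC.2.2) `<=`
      cball nC.2 `\` point_nbhd (s nC.1 nC.2, beta * nC.2.2).
    case: nC => n [x r] /=; have [r0|_] := ltP 0 r; last by exists 0.
    have [x' ?] := bob_move x (s n (x, r)) d0 beta0 (ltW beta1) r0.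
    by exists x'.
  have [mv mvP] := choice H.
  by exists (fun n C => mv (n, C)) => n C; exact: (mvP (n, C)).
pose b := fix b n := if n is n'.+1 then (mv n' (b n'), beta * (b n').2) else B.
have brad n : (b n).2 = beta ^+ n * B.2.
  by elim: n => [|n IH] /=; rewrite ?mul1r // IH exprS mulrA.
have bpos n : 0 < (b n).2 by rewrite brad mulr_gt0 // exprn_gt0.
exists b; first by split => // n; exact: mvP.
move=> e e0; have /cvgrPdist_le /(_ (e / B.2)) : (beta ^+ n @[n --> \oo] --> 0).
  by apply: cvg_expr; rewrite ger0_norm ?ltW //; lra.
rewrite divr_gt0 // => /(_ isT) [N _ HN]; exists N => n Nn.
rewrite brad -ler_pdivlMr //; have := HN n Nn.
by rewrite /= sub0r normrN ger0_norm // exprn_ge0 // ltW.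
Qed.

Lemma play_cluster_center beta Q s b (k : nat -> nat) : play beta Q s b ->
  (forall n, (n <= k n)%N) ->
  exists x, forall (e : R) N, 0 < e ->
    exists2 n, (N <= n)%N & euclid_norm ((b (k n)).1 - x) < e.
Proof.
move=> bplay kge; have [pos _ _ _] := bplay.
have [|x [_ clx]] := @cball_compact (b 0%N)
    ((fun n => (b (k n)).1) @ \oo) _ _.
  exists 0%N => // n _ /=; apply: (play_nested bplay (leq0n (k n))).
  by apply: cball_center; exact: ltW.
exists x => e N e0.
have HA : ((fun n => (b (k n)).1) @ \oo)
    ((fun n => (b (k n)).1) @` [set n | (N <= n)%N]).
  by exists N => // n Nn; exists n.
have HB : nbhs x [set y : 'rV[R]_d | euclid_norm (y - x) < e].
  apply: open_nbhs_nbhs; split => /=; last by rewrite subrr euclid_norm0.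
  have -> : [set y | euclid_norm (y - x) < e] =
    (fun y => euclid_norm (y - x)) @^-1` [set r : R | r < e] by [].
  apply: open_comp; last exact: open_lt.
  by move=> y _; exact: euclid_dist_continuous.
by have [y [[n Nn <-] yx]] := clx _ _ HA HB; exists n.
Qed.

(** The strategy may depend on Bob's first ball, over which constants can be made uniform by
    compactness. If the play does not shrink, the hypothesis is used a second time, for a ball
    contained in all of Bob's balls. *)
Lemma absolute_winning_onI U S : (0 < d)%N ->
  (forall B, 0 < B.2 -> cball B `<=` U -> forall beta : R, 0 < beta -> beta < 1 ->
    exists s, forall b, play beta (cball B) s b -> shrinking b ->
      \bigcap_n cball (b n) `<=` S) ->
  absolute_winning_on U S.
Proof.
move=> d0 win beta beta0 beta1.
have beta1' : beta < 1 by lra.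
have win' B : exists s, 0 < B.2 -> cball B `<=` U ->
    forall b, play beta (cball B) s b -> shrinking b ->
    \bigcap_n cball (b n) `<=` S.
  have [B0|_] := ltP 0 B.2; last by exists (fun _ _ => 0).
  have [BU|nBU] := pselect (cball B `<=` U); last by exists (fun _ _ => 0).
  by have [s sP] := win B B0 BU beta beta0 beta1'; exists s.
have [s sP] := choice win'.
(* The history yields the first ball, the turn number and the current ball; [(0, 0)] is the default
   for an empty history. *)
exists (fun h => (s (head (0, 0) h) (size h).-1 (last (0, 0) h),
                  beta * (last (0, 0) h).2)); split.
  by move=> h B B0 /=; rewrite last_rcons mulr_gt0.
move=> b [b0 bU bP].
have bpos n : 0 < (b n).2.
  by elim: n => // n IH; apply: lt_le_trans (bP n).2; rewrite mulr_gt0.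
have bplay : play beta (cball (b 0%N)) (s (b 0%N)) b.
  split => // n; last exact: (bP n).2.
  have := (bP n).1.
  by rewrite size_mkseq [last _ _](_ : _ = b n) // mkseqS last_rcons.
have [shr|/existsNP [e /not_implyP [e0 /forallNP nshr]]] := pselect (shrinking b).
  have [x xP] := play_cluster_center bplay (fun n => leqnn n).
  have bx : (\bigcap_n cball (b n)) x.
    move=> N _; rewrite /cball /=; apply/ler_addgt0Pr => e /(xP e N) [n Nn H].
    have := @play_nested _ _ _ _ N n bplay Nn (b n).1 (cball_center (ltW (bpos n))).
    rewrite /cball /= => H'.
    have := euclid_normD (x - (b n).1) ((b n).1 - (b N).1).
    by rewrite addrA subrK (euclid_normB x); lra.
  by exists x; split => //; exact: (sP _ b0 bU b bplay).
(* Infinitely many balls have radius above [e]; those whose centre is within [e / 2] of a cluster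
   point [x] contain the ball of radius [e / 2] about [x]. *)
have /choice [k kP] : forall N, exists n, (N <= n)%N /\ e < (b n).2.
  move=> N; have /existsNP [n /not_implyP [Nn /negP]] := nshr N.
  by rewrite -ltNge => ?; exists n.
have [x xP] := play_cluster_center bplay (fun n => (kP n).1).
have sub : cball (x, e / 2) `<=` \bigcap_n cball (b n).
  move=> y yx N _; have [|n Nn H] := xP (e / 2) N; first by lra.
  have [nk ek] := kP n.
  apply: (play_nested bplay (leq_trans Nn nk)); move: yx; rewrite /cball /= => yx.
  have := euclid_normD (y - x) (x - (b (k n)).1).
  by rewrite addrA subrK (euclid_normB x); lra.
have e2 : 0 < ((x, e / 2) : 'rV[R]_d * R).2 by rewrite /=; lra.
have subb : cball (x, e / 2) `<=` cball (b 0%N) by move=> y /sub /(_ 0%N I).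
have [s' s'P] := win _ e2 (subset_trans subb bU) beta beta0 beta1'.
have [b' b'play b'shr] := shrinking_play_exists s' d0 beta0 beta1 e2.
(* The limit of the auxiliary play lies in [S] and in every ball of the original one. *)
have [y yP] := play_cluster_center b'play (fun n => leqnn n).
have [b'pos b'0 _ _] := b'play.
have b'y : (\bigcap_n cball (b' n)) y.
  move=> N _; rewrite /cball /=; apply/ler_addgt0Pr => e' /(yP e' N) [n Nn H].
  have := @play_nested _ _ _ _ N n b'play Nn (b' n).1 (cball_center (ltW (b'pos n))).
  rewrite /cball /= => H'.
  have := euclid_normD (y - (b' n).1) ((b' n).1 - (b' N).1).
  by rewrite addrA subrK (euclid_normB y); lra.
exists y; split; last exact: (s'P b').
by apply: sub; apply: b'0; exact: b'y.
Qed.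

(* In dimension 0 Bob has no legal second move. *)
Lemma absolute_winning_on_dim0 U S : d = 0%N -> absolute_winning_on U S.
Proof.
move=> d0 beta beta0 beta1.
exists (fun h => (0, beta * (last (0, 0) h).2)); split.
  by move=> h B B0 /=; rewrite last_rcons mulr_gt0.
move=> b [b0 bU bP]; exfalso.
have e0 (v : 'rV[R]_d) : euclid_norm v = 0.
  apply/eqP; rewrite eq_le euclid_norm_ge0 andbT.
  by rewrite (le_trans (euclid_le_norm v)) // mulr_le0_ge0 // lern0 d0.
have [sub rat] := bP 0%N.
have [|_] := sub (b 1%N).1.
  by apply: cball_center; apply: le_trans rat; rewrite mulr_ge0 // ltW.
by apply; rewrite /point_nbhd /= e0 mulr_gt0.
Qed.

End Game.

(** * Bounded distortion and the game strategy *)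

Section Dynamics.
Context {R : realType} {M : topologicalType}.
Context (D : M -> M -> R) (f : M -> M) (a : M -> R) (sigma theta t : R).
Context (M_compact : compact [set: M]) (M_hausdorff : hausdorff_space M)
  (f_continuous : continuous f).
Context (sigma_gt1 : 1 < sigma) (theta_gt0 : 0 < theta) (t_gt0 : 0 < t).
Context (D_ge0 : forall p q, 0 <= D p q) (Dxx : forall p, D p p = 0)
  (D_gt0 : forall p q, p != q -> 0 < D p q).
Context (a_ge : forall p, sigma <= a p)
  (D_conformal : forall p q, D p q <= t ->
    `|D (f p) (f q) - a p * D p q| <= t^-1 * D p q `^ theta * D p q).
Context (D_small : forall (y : M) (e : R), 0 < e ->
    exists2 V : set M, nbhs y V & forall p q, V p -> V q -> D p q <= e)
  (D_nbhs : forall (y : M) (V : set M), nbhs y V -> exists2 e : R, 0 < e &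
    \forall p \near y, forall q, D p q <= e -> V q)
  (D_qsym : exists K e : R, [/\ 0 < K, 0 < e &
    forall p q, D p q <= e -> D q p <= K * D p q]).

Local Notation "p ^[ k ]" := (iter k f p) (at level 2, format "p ^[ k ]").

(** This is [L_k p], the conformal factor of the [k]-th iterate at [p]. Of [D] neither symmetry nor
    a triangle inequality is assumed; [D_qsym] is a local substitute for the former. *)
Definition scale (k : nat) (p : M) : R := \prod_(j < k) a p^[j].

Lemma scaleS k p : scale k.+1 p = a p^[k] * scale k p.
Proof. by rewrite /scale big_ord_recr /= mulrC. Qed.

Lemma scaleD j k p : scale (j + k) p = scale j p^[k] * scale k p.
Proof.
elim: j => [|j IH]; first by rewrite add0n [scale 0 _]big_ord0 mul1r.
by rewrite addSn !scaleS IH iterD mulrA.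
Qed.

Lemma sigma_gt0 : 0 < sigma.
Proof. exact: lt_trans sigma_gt1. Qed.

Lemma a_gt0 p : 0 < a p.
Proof. exact: lt_le_trans sigma_gt0 (a_ge p). Qed.

Lemma scale_ge k p : sigma ^+ k <= scale k p.
Proof.
elim: k => [|k IH]; first by rewrite /scale big_ord0.
by rewrite scaleS exprS ler_pM ?a_ge ?exprn_ge0 // ltW // sigma_gt0.
Qed.

Lemma scale_gt0 k p : 0 < scale k p.
Proof. by apply: lt_le_trans (scale_ge k p); rewrite exprn_gt0 // sigma_gt0. Qed.

Lemma scale_mono j k p : (j <= k)%N -> scale j p <= scale k p.
Proof.
move=> /subnK <-; rewrite scaleD -[leLHS]mul1r ler_wpM2r ?(ltW (scale_gt0 _ _))//.
by rewrite (le_trans _ (scale_ge _ _)) // exprn_ege1 // ltW.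
Qed.

Lemma powR_small (e : R) : 0 < e -> exists2 u : R, 0 < u &
  forall x, 0 <= x -> x <= u -> x `^ theta <= e.
Proof.
move=> e0; exists (e `^ theta^-1); first by rewrite powR_gt0.
move=> x x0 xu; rewrite (le_trans (ge0_ler_powR (ltW theta_gt0) _ _ xu)) ?nnegrE ?powR_ge0 //.
by rewrite -powRrM mulVf ?gt_eqF // powRr1 // ltW.
Qed.

Definition tau : R := (sigma + 1) / 2.

Lemma tau_gt1 : 1 < tau. Proof. by rewrite /tau; have := sigma_gt1; lra. Qed.

(** At small distances the relative error in [D_conformal] is at most [(sigma - 1) / 2], which
    leaves the expansion factor [tau]. The bound [1 / 2] serves to replace [1 - z] by an
    exponential. *)
Lemma expanding_scale : exists u : R, [/\ 0 < u, u <= t,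
  forall p q, D p q <= u -> tau * D p q <= D (f p) (f q) &
  forall p q, D p q <= u -> t^-1 * D p q `^ theta <= 1 / 2].
Proof.
have [|u u0 uP] := powR_small (e := t * Num.min (1 / 2) ((sigma - 1) / 2)).
  by rewrite mulr_gt0 // lt_min; have ? := sigma_gt1; apply/andP; split; lra.
exists (Num.min u t).
have small p q : D p q <= Num.min u t ->
    t^-1 * D p q `^ theta <= Num.min (1 / 2) ((sigma - 1) / 2).
  rewrite le_min => /andP[pu _].
  by rewrite mulrC ler_pdivrMr // mulrC uP.
split => [| |p q pq|p q pq].
- by rewrite lt_min u0.
- by rewrite ge_min lexx orbT.
- have := small p q pq; rewrite le_min => /andP[_ s2].
  move: pq; rewrite le_min => /andP[_ /D_conformal].
  rewrite ler_norml => /andP[H _]; have := a_ge p; have := D_ge0 p q.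
  have := sigma_gt1.
  rewrite /tau; move: s2 H; move: (t^-1 * _) => z; nra.
- by have := small p q pq; rewrite le_min => /andP[].
Qed.

(* [A] is chosen so that the logarithmic error [2 t^-1 x ^ theta] made at a
   step is at most the increment of [A x ^ theta], [x] being the current
   distance, which is multiplied by at least [tau]. *)
Lemma scale_distortion (u : R) : u <= t ->
  (forall p q, D p q <= u -> tau * D p q <= D (f p) (f q)) ->
  (forall p q, D p q <= u -> t^-1 * D p q `^ theta <= 1 / 2) ->
  exists2 A : R, 0 <= A & forall p q k,
    (forall j, (j < k)%N -> D p^[j] q^[j] <= u) ->
    let L := scale k p * D p q in
    L * expR (- (A * D p^[k] q^[k] `^ theta)) <= D p^[k] q^[k] /\
    D p^[k] q^[k] <= L * expR (A * D p^[k] q^[k] `^ theta).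
Proof.
move=> ut Hexp Hhalf.
have tau1 : 1 < tau `^ theta.
  have := gt0_ltr_powR theta_gt0 (_ : 1 \in Num.nneg) (_ : tau \in Num.nneg) tau_gt1.
  by rewrite powR1; apply; rewrite nnegrE // ltW // (lt_trans ltr01 tau_gt1).
have t1 : 0 < t^-1 by rewrite invr_gt0.
exists (2 * t^-1 / (tau `^ theta - 1)).
  by rewrite divr_ge0 ?mulr_ge0 ?ltW // subr_gt0.
set A := _ / _.
have A0 : 0 <= A by rewrite divr_ge0 ?mulr_ge0 ?ltW // subr_gt0.
have AE : A * (tau `^ theta - 1) = 2 * t^-1 by rewrite divfK // gt_eqF // subr_gt0.
move=> p q; elim=> [|k IH] Hk L.
  rewrite /L /scale big_ord0 mul1r /=.
  have z0 : 0 <= A * D p q `^ theta by rewrite mulr_ge0 // powR_ge0.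
  split; first by rewrite ler_piMr // -expR0 ler_expR; lra.
  by rewrite ler_peMr // -expR0 ler_expR.
have {IH}[IH1 IH2] := IH (fun j jk => Hk j (ltnW jk)).
have xu := Hk k (ltnSn k).
have xt := le_trans xu ut.
have := D_conformal xt; have := Hexp _ _ xu; have := Hhalf _ _ xu.
rewrite /L scaleS /=.
move: (D_ge0 p^[k] q^[k]) (a_ge p^[k]) IH1 IH2.
set x := D p^[k] q^[k]; set y := D (f _) (f _); set L0 := scale k p * D p q.
set b := a _ => x0 b_ge IH1 IH2 half taux /ler_normlP [y1 y2].
have b0 : 0 < b by exact: lt_le_trans sigma_gt0 b_ge.
have y0 : 0 <= y by apply: D_ge0.
have L00 : 0 <= L0 by rewrite mulr_ge0 // ltW // scale_gt0.
have Ay : A * x `^ theta + 2 * (t^-1 * x `^ theta) <= A * y `^ theta.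
  have -> : A * x `^ theta + 2 * (t^-1 * x `^ theta) = A * (tau * x) `^ theta.
    rewrite powRM ?(ltW (lt_trans ltr01 tau_gt1)) //.
    by rewrite [2 * _]mulrA -AE; ring.
  rewrite ler_wpM2l // ge0_ler_powR ?nnegrE ?(ltW theta_gt0) //.
  by rewrite mulr_ge0 // ltW // (lt_trans ltr01 tau_gt1).
have p0 : 0 <= t^-1 * x `^ theta by rewrite mulr_ge0 ?powR_ge0 // ltW.
move: p0 half y1 y2 Ay; set z := t^-1 * _ => z0 half y1 y2 Ay.
rewrite -[_ * scale k p * D p q]mulrA -/L0.
move: IH1 IH2 Ay; set X := A * x `^ theta; set Y := A * y `^ theta => IH1 IH2 Ay.
clearbody L0 X Y z.
(* Since [b >= 1], the error [z * x] is at most the fraction [z] of the main term [b * x]. *)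
have zx : z * x <= b * (z * x).
  by rewrite ler_peMl ?mulr_ge0 // (le_trans _ b_ge) // ltW // sigma_gt1.
split.
  apply: (le_trans (y := b * (L0 * expR (- X) * expR (- (2 * z))))).
    rewrite -!mulrA ler_pM2l // ler_wpM2l //. rewrite -expRD ler_expR; lra.
  (* Uses [expR (- (2 * z)) <= 1 - z], valid for [0 <= z <= 1 / 2]. *)
  apply: (le_trans (y := b * (x * (1 - z)))).
    rewrite ler_pM2l // ler_pM ?mulr_ge0 ?expR_ge0 //.
    rewrite expRN -[leLHS]mul1r ler_pdivrMr ?expR_gt0 //.
    have := expR_ge1Dx (2 * z); nra.
  nra.
apply: (le_trans (y := b * (L0 * expR X * expR z))).
  apply: (le_trans (y := b * (x * (1 + z)))); first nra.
  rewrite ler_pM2l // ler_pM ?expR_ge1Dx //; lra.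
rewrite -!mulrA ler_pM2l // ler_wpM2l // -expRD ler_expR; lra.
Qed.

(** [scale_distortion] needs all intermediate distances to be small. They are so by induction on
    time: each is at most a constant times its scaled value, and the scaled values increase up to
    time [k]. Exchanging the two points then compares their scales. *)
Lemma bounded_distortion : exists eta K : R, [/\ 0 < eta, 0 < K &
  forall p q k, p != q -> scale k p * D p q <= eta ->
    [/\ scale k p * D p q <= K * D p^[k] q^[k],
        D p^[k] q^[k] <= K * (scale k p * D p q) &
        scale k q <= K * scale k p]].
Proof.
have [u [u0 ut Hexp Hhalf]] := expanding_scale.
have [A A0 AP] := scale_distortion ut Hexp Hhalf.
have [K2 [e2 [K20 e20 K2P]]] := D_qsym.
pose K1 := expR (A * u `^ theta).
have K11 : 1 <= K1 by rewrite -expR0 ler_expR mulr_ge0 // powR_ge0.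
have K10 : 0 < K1 by exact: expR_gt0.
have bd p q k : (forall j, (j <= k)%N -> D p^[j] q^[j] <= u) ->
    scale k p * D p q <= K1 * D p^[k] q^[k] /\
    D p^[k] q^[k] <= K1 * (scale k p * D p q).
  move=> Hk; have [H1 H2] := AP p q k (fun j jk => Hk j (ltnW jk)).
  have L0 : 0 <= scale k p * D p q by rewrite mulr_ge0 // ltW // scale_gt0.
  have le1 : expR (A * D p^[k] q^[k] `^ theta) <= K1.
    by rewrite ler_expR ler_wpM2l // ge0_ler_powR ?nnegrE ?(ltW theta_gt0) ?(ltW u0) // Hk.
  split.
    move: H1; rewrite expRN ler_pdivrMr ?expR_gt0 // => /le_trans; apply.
    by rewrite mulrC ler_wpM2r.
  by apply: (le_trans H2); rewrite mulrC ler_wpM2r.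
(* Distances up to [v] stay below [u] and [e2] even after the two points are exchanged. *)
pose v := Num.min u (Num.min e2 (Num.min (u / K2) (e2 / K2))).
have v0 : 0 < v by rewrite !lt_min u0 e20 !divr_gt0.
have vu : v <= u by rewrite ge_min lexx.
(* [K1] pays for the distortion up to the current time, [2] for the next step of the induction. *)
exists (v / (2 * K1)), (Num.max K1 (K1 * K1 * K2 * K2)).
split; first by rewrite divr_gt0 // mulr_gt0.
  by rewrite lt_max K10.
move=> p q k pq; rewrite ler_pdivlMr ?mulr_gt0 // => Lk.
have Dpq := D_gt0 pq.
have small j : (j <= k)%N -> D p^[j] q^[j] <= v.
  elim/ltn_ind: j => -[_ _|j IH jk].
    apply: le_trans Lk; rewrite /= -[leLHS]mul1r -[leLHS]mulr1.
    have s1 := le_trans (exprn_ege1 k (ltW sigma_gt1)) (scale_ge k p).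
    apply: ler_pM; [by rewrite mul1r | exact: ler01 | | lra].
    by rewrite ler_wpM2r.
  have jv i : (i <= j)%N -> D p^[i] q^[i] <= v.
    by move=> ij; apply: IH; [rewrite ltnS|exact: leq_trans (ltnW jk)].
  have ju i : (i <= j)%N -> D p^[i] q^[i] <= u by move=> /jv /le_trans; apply.
  have [_ H] := bd p q j ju.
  have mono := scale_mono p jk.
  have /ler_normlP [_ y2] := D_conformal (le_trans (ju j (leqnn j)) ut).
  have h := Hhalf _ _ (ju j (leqnn j)).
  apply: le_trans Lk => /=.
  apply: (le_trans (y := 2 * (a p^[j] * D p^[j] q^[j]))).
    have x0 := D_ge0 p^[j] q^[j].
    have b1 : 1 <= a p^[j] := le_trans (ltW sigma_gt1) (a_ge _).
    by move: y2 h; move: (t^-1 * _) => z y2 h; nra.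
  apply: (le_trans (y := 2 * (a p^[j] * (K1 * (scale j p * D p q))))).
    by rewrite ler_pM2l // ler_pM2l // a_gt0.
  have -> : 2 * (a p^[j] * (K1 * (scale j p * D p q))) =
     2 * K1 * D p q * scale j.+1 p by rewrite scaleS; ring.
  rewrite [leRHS](_ : _ = 2 * K1 * D p q * scale k p); last by ring.
  by rewrite ler_pM2l // !mulr_gt0.
have qs j : (j <= k)%N -> D q^[j] p^[j] <= K2 * D p^[j] q^[j].
  move=> /small sj; apply: K2P; apply: le_trans sj _.
  by rewrite /v !ge_min lexx !orbT.
have small' j : (j <= k)%N -> D q^[j] p^[j] <= u /\ D q^[j] p^[j] <= e2.
  move=> jk; have := qs j jk; have := small j jk; rewrite /v !le_min.
  move=> /and4P[_ _]; rewrite !ler_pdivlMr // => h1 h2 h3.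
  by split; rewrite (le_trans h3) // mulrC.
have [b1 b2] := bd p q k (fun j jk => le_trans (small j jk) vu).
have [b3 b4] := bd q p k (fun j jk => (small' j jk).1).
have r1 := K2P _ _ (small' 0%N (leq0n k)).2.
have r2 := qs k (leqnn k).
rewrite /= in r1.
split.
- by rewrite (le_trans b1) // ler_wpM2r // le_max lexx.
- rewrite (le_trans b2) // ler_wpM2r // ?le_max ?lexx // mulr_ge0 //.
  by rewrite ltW // scale_gt0.
- rewrite -(ler_pM2r Dpq).
  (* Exchange the points, go forward with the scale of [q], exchange again at time [k], and go back
     with the scale of [p]. *)
  apply: (le_trans (y := scale k q * (K2 * D q p))).
    by rewrite ler_pM2l ?scale_gt0.
  apply: (le_trans (y := K2 * (K1 * (K2 * (K1 * (scale k p * D p q)))))).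
    rewrite mulrCA ler_pM2l // (le_trans b3) // ler_pM2l // (le_trans r2) //.
    by rewrite ler_pM2l.
  rewrite [leLHS](_ : _ = K1 * K1 * K2 * K2 * (scale k p * D p q)); last by ring.
  rewrite -[leRHS]mulrA ler_wpM2r // ?le_max ?lexx ?orbT // mulr_ge0 //.
  by rewrite ltW // scale_gt0.
Qed.

(** Expansion at small distances makes [f] locally injective, and continuity carries this to the
    iterates. *)
Lemma iter_isolated k (y : M) : \forall q \near y, q <> y -> q^[k] <> y^[k].
Proof.
elim: k y => [|k IH] y; first by near=> q.
have [u [u0 ut Hexp _]] := expanding_scale.
have [V yV VP] := D_small y u0.
have Vy := nbhs_singleton yV.
have := @f_continuous y _ (IH (f y)); rewrite nbhs_filterE => fy.
near=> q => qy; rewrite !iterSr.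
suff : f q <> f y by near: q; exact: fy.
move=> fqy.
have Vq : V q by near: q.
have := Hexp _ _ (VP _ _ Vq Vy); rewrite fqy Dxx.
have := D_gt0 (introN eqP qy); have := tau_gt1; nra.
Unshelve. all: by end_near. Qed.

Lemma iter_continuous k : continuous (iter k f).
Proof.
elim: k => [|k IH] x; first exact: cvg_id.
exact: (continuous_comp (IH x) (@f_continuous _)).
Qed.

Lemma closed_set1_hausdorff (y : M) : closed [set y].
Proof. exact: (@accessible_closed_set1 _ (hausdorff_accessible M_hausdorff)). Qed.

(** Near [y], no point other than [y] itself is mapped to [y] by the [j]-th iterate. Hence the part
    of the closure of a small [V0] outside [V] has a compact image missing [y], and [W] is the
    complement of that image. *)
Lemma return_nbhs j (y : M) : exists2 V0 : set M, nbhs y V0 & forall V, nbhs y V ->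
  exists2 W : set M, nbhs y W & forall q, V0 q -> W q^[j] -> V q.
Proof.
(* If [y] is periodic this is isolation; otherwise, by continuity, no point near [y] is mapped to
   [y]. *)
have [U yU UP] : exists2 U : set M, nbhs y U & forall q, U q -> q^[j] = y -> q = y.
  have [yj|nyj] := pselect (y^[j] = y).
    exists [set q | q <> y -> q^[j] <> y^[j]]; first exact: iter_isolated.
    by move=> q /= H qj; apply: contrapT => /H; rewrite yj.
  exists [set q | q^[j] <> y] => [|q /= H /H//].
  apply: (@iter_continuous j y [set z | z <> y]).
  apply: open_nbhs_nbhs; split=> //; rewrite -[X in open X]/(~` [set y]).
  exact: closed_openC (@closed_set1_hausdorff y).
have [V0 yV0 V0U] := compact_regular M_hausdorff M_compact (@filterT _ (nbhs y) _) yU.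
exists V0 => // V yV.
pose C := closure V0 `\` interior V.
have Ccompact : compact C.
  apply: (subclosed_compact _ M_compact) => //.
  by apply: closedI; [exact: closed_closure | exact: open_closedC (open_interior V)].
have fCclosed : closed (iter j f @` C).
  apply: compact_closed => //; apply: continuous_compact => //.
  by apply: continuous_subspaceT; exact: iter_continuous.
exists (~` (iter j f @` C)).
  apply: open_nbhs_nbhs; split; first exact: closed_openC.
  move=> [q [V0q Vq] qy]; apply: Vq.
  by rewrite (UP q (V0U _ V0q) qy).
move=> q V0q nC; apply: interior_subset; apply: contrapT => nV.
by apply: nC; exists q => //; split => //; exact: subset_closure.
Qed.

(** The order of choice matters: [V0] is fixed before [V], so that the size of [V] may depend on
    constants derived from [V0]. *)
Lemma return_nbhs_below N (y : M) : exists2 V0 : set M, nbhs y V0 & forall V, nbhs y V ->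
  exists2 W : set M, nbhs y W & forall j q, (j < N)%N -> V0 q -> W q^[j] -> V q.
Proof.
elim: N => [|N [V1 yV1 V1P]].
  by exists setT; [exact: filterT|move=> V yV; exists setT => //; exact: filterT].
have [V2 yV2 V2P] := return_nbhs N y.
exists (V1 `&` V2) => [|V yV]; first exact: filterI.
have [W1 yW1 W1P] := V1P _ yV; have [W2 yW2 W2P] := V2P _ yV.
exists (W1 `&` W2) => [|j q]; first exact: filterI.
rewrite ltnS leq_eqVlt => /orP[/eqP -> [_ V2q] [_ W2q]|jN [V1q _] [W1q _]].
  exact: W2P.
exact: (W1P j).
Qed.

Lemma exists_expr_ge (B : R) : exists N, B <= sigma ^+ N.
Proof.
have [B0|B0] := leP B 0.
  by exists 0%N; rewrite (le_trans B0).
have s0 := sigma_gt0.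
have /cvgrPdist_le /(_ B^-1) : (sigma^-1 ^+ n @[n --> \oo] --> 0).
  by apply: cvg_expr; rewrite ger0_norm ?invr_ge0 ?(ltW s0) // invf_lt1.
rewrite invr_gt0 => /(_ B0) [N _ /(_ N (leqnn N))] /=.
rewrite sub0r normrN exprVn ger0_norm ?invr_ge0 ?exprn_ge0 ?(ltW s0) // => H.
by exists N; rewrite -lef_pV2 ?posrE // exprn_gt0.
Qed.

(** * The two games in a chart, for one map and one point *)

Section ChartGame.
Context {d : nat} (P : 'rV[R]_d -> M) (Q : set 'rV[R]_d).
Context (P_continuous : forall x, Q x -> {for x, continuous P})
  (P_inj : forall x x', Q x -> Q x' -> P x = P x' -> x = x')
  (P_bilip : exists K e : R, [/\ 0 < K, 0 < e &
    forall x x', Q x -> Q x' -> `|x - x'| <= e ->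
      `|x - x'| <= K * D (P x) (P x') /\ D (P x) (P x') <= K * `|x - x'|]).

(** Alice removes a neighbourhood of some solution of [(P p)^[k] = y] in the current ball, if there
    is one. Solutions are isolated, so once the ball is small around a limit [x] that is a solution,
    the chosen point is [x]. *)
Lemma iter_neq_winning k (y : M) :
  positional_winning Q [set x | iter k f (P x) <> y].
Proof.
move=> beta beta0 beta1.
have /choice [s sP] : forall B : 'rV[R]_d * R, exists p, forall x,
    cball B x -> Q x -> (P x)^[k] = y -> cball B p /\ Q p /\ (P p)^[k] = y.
  move=> B.
  have [[p pP]|] := pselect (exists x, cball B x /\ Q x /\ (P x)^[k] = y).
    by exists p.
  by move=> H; exists 0 => x Bx Qx xy; exfalso; apply: H; exists x.
exists s => b bplay shr x bx; rewrite /= => xy.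
have [pos b0 sub _] := bplay.
have Qb n z : cball (b n) z -> Q z.
  by move=> bz; apply: b0; exact: (play_nested bplay (leq0n n)).
have Qx : Q x by apply: (Qb 0%N); exact: bx.
have : nbhs x [set x' | P x' <> P x -> (P x')^[k] <> (P x)^[k]].
  exact: (P_continuous Qx) (iter_isolated k (P x)).
move=> /nbhs_dist_leP [e e0 He].
have [|n /(_ n (leqnn n)) bn] := shr (e / 2); first by rewrite divr_gt0.
have bnx : cball (b n) x by exact: bx.
have [bp [Qp py]] := sP (b n) x bnx Qx xy.
have pe : `|s (b n) - x| <= e.
  by rewrite (le_trans (cball_diam bp bnx)) //; lra.
have px : s (b n) = x.
  apply: P_inj => //; apply: contrapT => /(He _ pe); by rewrite py xy.
have [_] := sub n x (bx n.+1 I).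
by apply; rewrite /point_nbhd /= px subrr euclid_norm0 mulr_gt0.
Qed.

Lemma limit_avoids_winning (y : M) :
  positional_winning Q [set x | exists2 W : set M, nbhs y W &
    exists k0, forall k, (k0 <= k)%N -> ~ W (iter k f (P x))].
Proof.
move=> beta beta0 beta1.
have [eta [K [eta0 K0 KP]]] := bounded_distortion.
have [K3 [e3 [K30 e30 K3P]]] := P_bilip.
(* [N] bounds the gap between two times belonging to the same window. *)
have [N NP] := exists_expr_ge (K / beta).
have [V0 yV0 V0P] := return_nbhs_below N.+1 y.
have [e5 e50 e5P] := D_nbhs yV0.
(* Points of a ball of radius [rho] are at chart distance at most [2 * rho], so their scaled
   distance is at most [2 * K3 * c]. This must allow bounded distortion and keep their images within
   [e5]. *)
pose c := Num.min eta (e5 / K) / (2 * K3).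
have c0 : 0 < c by rewrite divr_gt0 ?lt_min ?eta0 ?divr_gt0 ?mulr_gt0.
have ceta : 2 * K3 * c <= eta.
  by rewrite mulrC divfK ?gt_eqF ?mulr_gt0 // ge_min lexx.
have ce5 : K * (2 * K3 * c) <= e5.
  rewrite mulrC -ler_pdivlMr // mulrC divfK ?gt_eqF ?mulr_gt0 //.
  by rewrite ge_min lexx orbT.
clearbody c.
(* Chosen to make the final separation at most [beta * B.2 / (d + 1)] in the sup norm, hence less
   than [beta * B.2] in the Euclidean one. *)
pose e2 := beta ^+ 2 * c / (K3 * K * (d%:R + 1)).
have d1 : 0 < d%:R + 1 :> R by rewrite ltr_wpDl.
have e20 : 0 < e2 by rewrite divr_gt0 ?mulr_gt0 ?exprn_gt0.
have [V yV VP] := D_small y e20.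
have [W0 yW0 W0P] := V0P V yV.
pose W := W0 `&` V `&` [set p | forall q, D p q <= e5 -> V0 q].
have yW : nbhs y W by apply: filterI; [exact: filterI|exact: e5P].
pose good (B : 'rV[R]_d * R) x k := [/\ cball B x, Q x, W (P x)^[k],
  beta * c <= B.2 * scale k (P x) & B.2 * scale k (P x) <= c].
(* One removal suffices: two good points, with possibly different times, are closer than the radius
   that Alice removes. *)
have half (B : 'rV[R]_d * R) x k x' k' : 0 < B.2 -> 2 * B.2 <= e3 -> (k <= k')%N ->
    good B x k -> good B x' k' -> euclid_norm (x - x') < beta * B.2.
  move=> B0 Be kk' [Bx Qx Wx lx ux] [Bx' Qx' Wx' lx' ux'].
  have [xx'|xx'] := eqVneq x x'.
    by rewrite xx' subrr euclid_norm0 mulr_gt0.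
  have dx := cball_diam Bx Bx'.
  have [l3 u3] := K3P _ _ Qx Qx' (le_trans dx Be).
  have [l3' u3'] := K3P _ _ Qx' Qx (le_trans (cball_diam Bx' Bx) Be).
  have Pxx' : P x != P x' by apply: contra_neq xx' => /P_inj; exact.
  have near_eta z z' j : D (P z) (P z') <= K3 * `|z - z'| ->
      `|z - z'| <= 2 * B.2 -> B.2 * scale j (P z) <= c ->
      scale j (P z) * D (P z) (P z') <= 2 * K3 * c.
    move=> h1 h2 h3; have h4 := scale_gt0 j (P z).
    apply: (le_trans (y := scale j (P z) * (K3 * (2 * B.2)))).
      by rewrite ler_pM2l // (le_trans h1) // ler_pM2l.
    by rewrite [leLHS](_ : _ = 2 * K3 * (B.2 * scale j (P z)));
      [rewrite ler_pM2l // mulr_gt0 | ring].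
  have ukx' : B.2 * scale k (P x') <= c.
    by rewrite (le_trans _ ux') // ler_pM2l // scale_mono.
  have h1 := near_eta x x' k u3 dx ux.
  have h2 := near_eta x' x k u3' (cball_diam Bx' Bx) ukx'.
  have [b1 b2 _] := KP _ _ k Pxx' (le_trans h1 ceta).
  have [_ _ b3] := KP (P x') (P x) k (contra_neq esym Pxx') (le_trans h2 ceta).
  (* A longer gap would multiply the scale of [x'] by more than [K / beta]; as its scale at time [k]
     is at least that of [x] divided by [K], it would leave the window by time [k']. *)
  have jN : (k' - k < N.+1)%N.
    rewrite ltnNge; apply/negP => jN.
    have := scaleD (k' - k) k (P x'); rewrite subnK // => E.
    have s1 := scale_gt0 k (P x').
    have s2 : sigma ^+ N.+1 <= scale (k' - k) (P x')^[k].
      rewrite (le_trans _ (scale_ge _ _)) // ler_weXn2l // ltW //.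
    have s3 : K / beta < scale (k' - k) (P x')^[k].
      apply: lt_le_trans s2; rewrite exprS.
      have : 0 < K / beta by rewrite divr_gt0.
      have := sigma_gt1; move: NP; move: (K / beta) (sigma ^+ N) => z w; nra.
    move: s3; rewrite ltr_pdivrMr // => s3.
    move: ux'; rewrite E => ux'.
    have : K * (B.2 * scale k (P x')) < c * beta.
      apply: (lt_le_trans (y := B.2 * (scale (k' - k) (P x')^[k] * scale k (P x')) * beta)).
        rewrite [ltRHS](_ : _ =
          scale (k' - k) (P x')^[k] * beta * (B.2 * scale k (P x'))); last by ring.
        by rewrite ltr_pM2r // mulr_gt0.
      by rewrite ler_pM2r.
    have : B.2 * scale k (P x) <= B.2 * (K * scale k (P x')) by rewrite ler_pM2l.
    lra.
  case: Wx => -[W0x Vx] near_y; case: Wx' => -[W0x' _] _.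
  (* At time [k] the orbit of [x'] is close to that of [x], hence in [V0]; since it visits [W0] at
     most [N] steps later, it is already in [V]. *)
  have V0x' : V0 (P x')^[k].
    apply: near_y; apply: (le_trans b2); apply: le_trans ce5.
    by rewrite ler_pM2l.
  have Vx' : V (P x')^[k].
    by apply: (W0P _ _ jN V0x'); rewrite -iterD subnK.
  have h3 := VP _ _ Vx Vx'.
  have s0 := scale_gt0 k (P x).
  (* The lower end of the window bounds the scale from below, and bounded distortion pulls the
     distance [e2] at time [k] back to the chart. *)
  have fin : B.2 * (beta * c) * `|x - x'| <= B.2 * (B.2 * (K3 * (K * e2))).
    apply: (le_trans (y := B.2 * (B.2 * (scale k (P x) * (K3 * D (P x) (P x')))))).
      rewrite -mulrA ler_pM2l // [leRHS]mulrA.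
      by apply: ler_pM => //; rewrite mulr_ge0 // ltW.
    rewrite ler_pM2l // ler_pM2l // mulrCA ler_pM2l // (le_trans b1) //.
    by rewrite ler_pM2l.
  have : B.2 * (B.2 * (K3 * (K * e2))) = B.2 * (beta * c) * (beta * B.2 / (d%:R + 1)).
    by rewrite /e2; field; rewrite !gt_eqF.
  move: fin => /[swap] ->; rewrite ler_pM2l ?mulr_gt0 // => fin.
  apply: (le_lt_trans (euclid_le_norm _)).
  apply: (le_lt_trans (y := d%:R * (beta * B.2 / (d%:R + 1)))).
    by rewrite ler_wpM2l.
  rewrite mulrCA -[ltRHS]mulr1 ltr_pM2l ?mulr_gt0 //.
  by rewrite ltr_pdivrMr // mul1r ltrDl.
have /choice [s sP] : forall B, exists p, forall x k, good B x k ->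
    exists k', good B p k'.
  move=> B; have [[p [k pP]]|H] := pselect (exists x k, good B x k).
    by exists p => _ _ _; exists k.
  by exists 0 => x k xk; exfalso; apply: H; exists x, k.
exists s => b bplay shr x bx.
have [pos b0 sub rat] := bplay.
have Qx : Q x by apply: b0; exact: bx.
exists W => //.
have [|i0 i0P] := shr (e3 / 2); first by rewrite divr_gt0.
(* For [k >= k0] the ball [b i0] is still above the window. The first later ball with product at
   most [c] is then in the window, because one turn shrinks the radius at most by [beta]. *)
have [k0 k0P] := exists_expr_ge ((c + 1) / (b i0).2).
exists k0 => k kk0 Wk.
have big : c < (b i0).2 * scale k (P x).
  rewrite mulrC -ltr_pdivrMr //.
  apply: (lt_le_trans (y := (c + 1) / (b i0).2)).
    by rewrite ltr_pM2r ?invr_gt0 // ltrDl.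
  rewrite (le_trans k0P) // (le_trans _ (scale_ge _ _)) // ler_weXn2l //.
  exact: ltW.
have s0 := scale_gt0 k (P x).
have ex : exists n, (i0 <= n)%N && ((b n).2 * scale k (P x) <= c).
  have [|n0 n0P] := shr (c / scale k (P x)); first by rewrite divr_gt0.
  exists (maxn i0 n0); rewrite leq_maxl /= -ler_pdivlMr // n0P //.
  exact: leq_maxr.
case: (ex_minnP ex) => n /andP[i0n nc] nmin.
have goodx : good (b n) x k.
  split=> //; first exact: bx.
  case: n i0n nc nmin => [|n] i0n nc nmin.
    by move: i0n; rewrite leqn0 => /eqP i00; move: big; rewrite i00 ltNge nc.
  have [i0n1|] := ltnP i0 n.+1; last first.
    by move=> ni0; move: big; rewrite (anti_leq (_ : i0 <= n.+1 <= i0)%N) ?i0n // ltNge nc.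
  have : c < (b n).2 * scale k (P x).
    rewrite ltNge; apply/negP => H.
    by have := nmin n; rewrite -ltnS i0n1 H /= ltnn => /(_ isT).
  move=> H; apply: (le_trans (y := beta * (b n).2 * scale k (P x))).
    by rewrite -mulrA ler_pM2l // ltW.
  by rewrite ler_pM2r.
have [k' goodp] := sP _ _ _ goodx.
have small_n : 2 * (b n).2 <= e3 by have := i0P n i0n; lra.
have [_] := sub n x (bx n.+1 I); apply; rewrite /point_nbhd /=.
have [kk'|/ltnW kk'] := leqP k k'; first exact: (half (b n) x k _ k').
by rewrite euclid_normB; exact: (half (b n) _ k' x k).
Qed.

End ChartGame.
End Dynamics.

(** * Differential calculus in charts *)

Section Calculus.
Context {R : realType}.

(** The scalar mean value theorem is applied to each coordinate of [F (x + s *: u) - s *: w]; the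
    sup norm allows a different intermediate point for each. Taking [w = 0] gives Lipschitz bounds,
    and taking the differential at [x] gives Taylor remainders. *)
Lemma segment_increment_le {m n : nat} (F : 'rV[R]_m -> 'rV[R]_n)
    (x u : 'rV[R]_m) (w : 'rV[R]_n) (K : R) :
  (forall s : R, 0 <= s <= 1 -> differentiable F (x + s *: u)) ->
  (forall s : R, 0 <= s <= 1 -> `|'d F (x + s *: u) u - w| <= K) ->
  `|F (x + u) - F x - w| <= K.
Proof.
move=> dF bF.
have K0 : 0 <= K by apply: le_trans (bF 0 _); rewrite ?lexx ?ler01.
pose line := fun s : R => x + s *: u.
have dline s : is_diff s line ( *:%R^~ u).
  have -> : line = cst x + ( *:%R^~ u) by [].
  rewrite -[X in is_diff _ _ X]add0r.
  exact: (is_diffD (is_diff_cst x s) (is_diff_scalel s u)).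
have derF (s : R) : 0 <= s <= 1 -> is_derive s 1 (F \o line) ('d F (line s) u).
  move=> s01; have dFs := dF s s01.
  have dcomp : differentiable (F \o line) s by exact: differentiable_comp.
  apply: DeriveDef; first exact: diff_derivable.
  by rewrite deriveE // diff_comp //= diff_val /= scale1r.
apply: norm_le_coord => // i.
pose phi := fun s : R => (F \o line) s 0 i - s * w 0 i.
have dphi (s : R) : 0 <= s <= 1 -> is_derive s 1 phi (('d F (line s) u - w) 0 i).
  move=> s01; have [d1 d2] := derF s s01.
  have := (derivable_mxP _ _ _).1 d1 0 i => d3.
  have d4 : 'D_1 (fun t => (F \o line) t 0 i) s = ('d F (line s) u) 0 i.
    by rewrite -d2 derive_mx // mxE.
  have d5 : is_derive s 1 (fun t => (F \o line) t 0 i) (('d F (line s) u) 0 i).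
    exact: DeriveDef.
  have d6 : is_derive s 1 (fun t : R => t * w 0 i) (w 0 i).
    have -> : (fun t : R => t * w 0 i) = (w 0 i \*: id).
      by apply/funext => t /=; rewrite mulrC.
    by apply: is_derive_eq; rewrite /= scaler1.
  have := is_deriveB d5 d6.
  by rewrite !mxE.
have [||c c01] := @MVT _ phi (fun s => ('d F (line s) u - w) 0 i) 0 1 ltr01.
- move=> s; rewrite in_itv /= => /andP[s0 s1]; apply: dphi.
  by rewrite !ltW.
- apply: derivable_within_continuous => s; rewrite in_itv /= => s01.
  by case: (dphi s s01).
rewrite /phi /= /line scale1r scale0r addr0 !mul1r mul0r !subr0 mulr1 => E.
rewrite !mxE.
have -> : F (x + u) 0 i - F x 0 i - w 0 i = ('d F (line c) u - w) 0 i.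
  by rewrite -E; ring.
apply: (le_trans (coord_le_norm _ _)); apply: bF.
by move: c01; rewrite in_itv /= => /andP[c0 c1]; rewrite !ltW.
Qed.

End Calculus.

Section GramComparison.
Context {R : realType} {d : nat}.

Lemma gram_form_continuous (G : 'rV[R]_d -> 'M[R]_d) (x v : 'rV[R]_d) :
  {for x, continuous G} ->
  (gram_form (G z.1) z.2 z.2) @[z --> (x, v)] --> gram_form (G x) v v.
Proof.
move=> Gx; rewrite /gram_form mxE.
under eq_cvg do rewrite mxE.
apply: cvg_big => [|j _]; first exact: add_continuous.
rewrite !mxE; under eq_cvg do rewrite !mxE.
have cv (i : 'I_d) :
    (fun z : 'rV[R]_d * 'rV[R]_d => z.2 0 i) @ nbhs (x, v) --> v 0 i.
  apply: (@cvg_comp _ _ _ snd (fun N : 'rV[R]_d => N 0 i) _ (nbhs v)).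
    exact: cvg_snd.
  exact: matrix_normedtype.coord_continuous.
apply: cvgM; last exact: cv.
apply: cvg_big => [|i _]; first exact: add_continuous.
apply: cvgM; first exact: cv.
apply: (@cvg_comp _ _ _ (fun z => G z.1) (fun N : 'M[R]_d => N i j) _ (nbhs (G x))).
  apply: (@cvg_comp _ _ _ fst G _ (nbhs x)); last exact: Gx.
  exact: cvg_fst.
exact: matrix_normedtype.coord_continuous.
Qed.

(** Joint continuity of the form and compactness of the unit sphere give one constant for all unit
    vectors and all nearby [y]; homogeneity does the rest. *)
Lemma gram_norm_comparable (G : 'rV[R]_d -> 'M[R]_d) (x : 'rV[R]_d) :
  {for x, continuous G} -> (forall w, w != 0 -> 0 < gram_form (G x) w w) ->
  exists2 k : R, 0 < k & \forall y \near x, forall v,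
    k * `|v| <= gram_norm (G y) v /\ gram_norm (G y) v <= k^-1 * `|v|.
Proof.
move=> Gx Gpos.
pose S : set 'rV[R]_d := [set v | `|v| = 1].
have Scompact : compact S.
  apply: bounded_closed_compact.
    exists 1; split; first exact: num_real.
    by move=> e e1 v /= ->; exact: ltW.
  have -> : S = (fun v : 'rV[R]_d => `|v|) @^-1` [set 1] by [].
  apply: preimage_closed; last exact: closed_eq.
  by move=> v _; exact: norm_continuous.
have := (compact_near_coveringP S).1 Scompact _
  (filter_prod (nbhs x) (0^'+ : set_system R))
  (fun yt v => yt.2 ^+ 2 <= gram_form (G yt.1) v v <= yt.2^-1 ^+ 2) _.
case.
  move=> v Sv.
  have v0 : v != 0 by rewrite -normr_eq0 Sv oner_eq0.
  have m0 := Gpos v v0; set m := gram_form (G x) v v in m0.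
  have cv := @gram_form_continuous G x v Gx.
  have lo : \forall z \near (x, v), m / 2 < gram_form (G z.1) z.2 z.2.
    by apply: (cvgr_gt _ cv); rewrite ltr_pdivrMr // ltr_pMr // ltr1n.
  have hi : \forall z \near (x, v), gram_form (G z.1) z.2 z.2 < 2 * m.
    by apply: (cvgr_lt _ cv); rewrite ltr_pMl // ltr1n.
  have := filterI lo hi => -[[A B] /= [xA vB] AB].
  exists (B, A `*` [set t | 0 < t /\ t ^+ 2 <= m / 2 /\ 2 * m <= t^-1 ^+ 2]) => /=.
    split => //; exists (A, [set t | 0 < t /\ t ^+ 2 <= m / 2 /\ 2 * m <= t^-1 ^+ 2]) => //=.
    split => //.
    (* For [t < e <= 1] one has [t ^+ 2 <= t], which yields both required bounds. *)
    pose e := Num.min 1 (Num.min (m / 2) (2 * m)^-1).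
    have e0 : 0 < e by rewrite !lt_min ltr01 divr_gt0 // invr_gt0 mulr_gt0.
    near=> t.
    have t0 : 0 < t by near: t; exact: nbhs_right_gt.
    have te : t < e by near: t; exact: nbhs_right_lt.
    move: te; rewrite !lt_min => /and3P[t1 tm tm'].
    have tt : t ^+ 2 <= t by rewrite expr2 ler_piMr // ltW.
    split => //; split; first by rewrite (le_trans tt) // ltW.
    rewrite exprVn -[leLHS]invrK lef_pV2 ?posrE ?invr_gt0 ?mulr_gt0 // ?exprn_gt0 //.
    by rewrite (le_trans tt) // ltW.
  case=> v' [y t] /= [Bv' [Ay [t0 [t1 t2]]]].
  have [h1 h2] := AB (y, v') (conj Ay Bv').
  by rewrite (le_trans t1) ?(ltW h1) // (le_trans (ltW h2)).
move=> [A B] /= [xA B0] AB.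
have [k [Bk k0]] : exists k, B k /\ 0 < k.
  have : \forall k \near (0 : R)^'+, B k /\ 0 < k.
    by apply: filterI => //; exact: nbhs_right_gt.
  by move=> /(@filter_ex _ _ (at_right_proper_filter (0 : R))) [k]; exists k.
exists k => //; apply: filterS xA => y Ay v.
have [->|v0] := eqVneq v 0; first by rewrite gram_norm0 normr0 !mulr0.
have nv : 0 < `|v| by rewrite normr_gt0.
have Su : S (`|v|^-1 *: v).
  by rewrite /S /= normrZ normfV normr_id mulVf // gt_eqF.
have /andP[h1 h2] := AB (y, k) (conj Ay Bk) _ Su.
have {h1 h2}[h1 h2] : k <= gram_norm (G y) (`|v|^-1 *: v) /\
    gram_norm (G y) (`|v|^-1 *: v) <= k^-1.
  split.
    by rewrite -[k]ger0_norm ?(ltW k0) // -sqrtr_sqr ler_wsqrtr.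
  rewrite -[leRHS]ger0_norm ?invr_ge0 ?(ltW k0) // -sqrtr_sqr ler_wsqrtr //.
move: h1 h2; rewrite gram_normZ ger0_norm ?invr_ge0 // => h1 h2.
by split; [rewrite -ler_pdivlMr // mulrC|rewrite -ler_pdivrMr // mulrC].
Unshelve. all: by end_near. Qed.

End GramComparison.

(** * Uniform constants from local ones *)

Section LocallySmall.
Context {R : realType} {T : topologicalType}.
Implicit Types (x : T) (A B : R -> T -> Prop).

(** A single parameter [t] encodes radii directly and upper bounds as [t^-1]. Admitting all small
    [t] lets finitely many local statements share one value, and compactness makes it global. *)
Definition locally_small x A : Prop := exists (V : set T) (t0 : R),
  [/\ nbhs x V, 0 < t0 & forall y t, V y -> 0 < t -> t <= t0 -> A t y].

Lemma locally_smallI x A B : locally_small x A -> locally_small x B ->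
  locally_small x (fun t y => A t y /\ B t y).
Proof.
move=> [V [v [xV v0 VA]]] [W [w [xW w0 WB]]].
exists (V `&` W), (Num.min v w); split; [exact: filterI| by rewrite lt_min v0|].
move=> y t [Vy Wy] t0; rewrite le_min => /andP[tv tw].
by split; [exact: VA | exact: WB].
Qed.

Lemma locally_smallS x A B : (forall t y, A t y -> B t y) ->
  locally_small x A -> locally_small x B.
Proof.
by move=> AB [V [v [xV v0 VA]]]; exists V, v; split=> // y t *; apply: AB; exact: VA.
Qed.

Lemma locally_small_nbhs x (V : set T) : nbhs x V ->
  locally_small x (fun _ y => V y).
Proof. by move=> xV; exists V, 1. Qed.

Lemma locally_small_seq (I : eqType) (s : seq I) x (A : I -> R -> T -> Prop) :
  (forall i, i \in s -> locally_small x (A i)) ->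
  locally_small x (fun t y => forall i, i \in s -> A i t y).
Proof.
elim: s => [|i s IH] H; first by exists setT, 1; split => //; exact: filterT.
have H1 := H i (mem_head _ _).
have H2 := IH (fun j js => H j (@mem_behead _ (i :: s) j js)).
apply: (locally_smallS _ (locally_smallI H1 H2)) => t y [Ai As] j.
by rewrite inE => /predU1P[->//|/As].
Qed.

Lemma compact_locally_small (K : set T) A : compact K ->
  (forall x, K x -> locally_small x A) ->
  exists2 t : R, 0 < t & forall x, K x -> A t x.
Proof.
move=> Kcompact H.
have := (compact_near_coveringP K).1 Kcompact R (0^'+ : set_system R) A _.
case.
  move=> x /H [V [t0 [xV t00 VA]]].
  exists (V, [set t | 0 < t /\ t <= t0]) => /=; last first.
    by case=> y t /= [Vy [t1 t2]]; exact: VA.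
  split => //; near=> t; split; first by near: t; exact: nbhs_right_gt.
  by near: t; exact: nbhs_right_le.
move=> e /= e0 He.
exists (e / 2); first by rewrite divr_gt0.
move=> x Kx; apply: He => //=; last by rewrite divr_gt0.
rewrite sub0r normrN ger0_norm ?divr_ge0 ?ltW //.
by rewrite ltr_pdivrMr // ltr_pMr // ltr1n.
Unshelve. all: by end_near. Qed.

End LocallySmall.

Section LocalCalculus.
Context {R : realType}.

Lemma segment_in_ball {m : nat} (x0 x u : 'rV[R]_m) (e s : R) :
  `|x - x0| <= e -> `|x + u - x0| <= e -> 0 <= s <= 1 ->
  `|x + s *: u - x0| <= e.
Proof.
move=> xe ye /andP[s0 s1].
have -> : x + s *: u - x0 = (1 - s) *: (x - x0) + s *: (x + u - x0).
  by apply/rowP => i; rewrite !mxE; ring.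
rewrite (le_trans (ler_normD _ _)) // !normrZ (ger0_norm s0) ger0_norm; last by lra.
have : (1 - s) * `|x - x0| <= (1 - s) * e by rewrite ler_wpM2l //; lra.
have : s * `|x + u - x0| <= s * e by rewrite ler_wpM2l.
lra.
Qed.

Lemma near_norm_le (V W : normedModType R) (h : V -> W) (x0 : V) :
  {for x0, continuous h} -> \forall x \near x0, `|h x| <= `|h x0| + 1.
Proof.
move=> /cvgrPdist_le /(_ 1 ltr01); apply: filterS => x ab.
have := ler_distD (h x0) (h x) 0; rewrite subr0 (distrC (h x)) subr0.
by move=> /le_trans; apply; rewrite addrC lerD2l.
Qed.

(** Continuity of the differential is given for each fixed vector only; its values on the basis
    vectors bound it as an operator. *)
Lemma locally_lipschitz {m n : nat} (F : 'rV[R]_m -> 'rV[R]_n) (x0 : 'rV[R]_m) :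
  (\forall x \near x0, differentiable F x) ->
  (forall v, {for x0, continuous (fun x => 'd F x v)}) ->
  exists K e : R, [/\ 0 < K, 0 < e & forall x y,
    `|x - x0| <= e -> `|y - x0| <= e -> `|F y - F x| <= K * `|y - x|].
Proof.
move=> dF cF.
have bd : \forall x \near x0, forall i : 'I_m,
    `|'d F x (delta_mx 0 i)| <= `|'d F x0 (delta_mx 0 i)| + 1.
  apply: (@filter_forall _ _ _ (nbhs x0) _) => i.
  exact: near_norm_le (cF (delta_mx 0 i)).
have : \forall x \near x0, differentiable F x /\
    forall i : 'I_m, `|'d F x (delta_mx 0 i)| <= `|'d F x0 (delta_mx 0 i)| + 1.
  exact: filterI dF bd.
move=> /nbhs_dist_leP [e e0 He].
pose K := \sum_(i < m) (`|'d F x0 (delta_mx 0 i)| + 1).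
have K0 : 0 <= K by apply: sumr_ge0 => i _; rewrite addr_ge0.
exists (K + 1), e; split=> //; first by rewrite ltr_wpDl.
move=> x y xe ye; set u := y - x.
have yE : y = x + u by rewrite /u addrC subrK.
have ye' : `|x + u - x0| <= e by rewrite -yE.
have bu z : `|z - x0| <= e -> `|'d F z u| <= K * `|u|.
  move=> /He [_ Hz].
  have -> : 'd F z u = \sum_i u 0 i *: 'd F z (delta_mx 0 i).
    rewrite [in LHS](row_sum_delta u) linear_sum /=.
    by apply: eq_bigr => i _; rewrite linearZ.
  rewrite mulr_suml (le_trans (ler_norm_sum _ _ _)) //; apply: ler_sum => i _.
  rewrite normrZ mulrC.
  by apply: ler_pM => //; exact: coord_le_norm.
have : `|F (x + u) - F x - 0| <= K * `|u|.
  apply: segment_increment_le => s s01.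
    by case: (He _ (segment_in_ball xe ye' s01)).
  by rewrite subr0; apply: bu; exact: segment_in_ball.
rewrite subr0 -yE => /le_trans; apply.
by rewrite ler_wpM2r // lerDl.
Qed.

Lemma holder_remainder {m n : nat} (F : 'rV[R]_m -> 'rV[R]_n) (x0 : 'rV[R]_m)
    (C theta : R) : 0 <= theta ->
  (\forall x \near x0, differentiable F x) ->
  (\forall y & z \near x0, forall v, `|'d F y v - 'd F z v| <=
      C * (`|y - z| `^ theta) * `|v|) ->
  exists2 e : R, 0 < e & forall x y, `|x - x0| <= e -> `|y - x0| <= e ->
    `|F y - F x - 'd F x (y - x)| <= `|C| * (`|y - x| `^ theta) * `|y - x|.
Proof.
move=> theta0 dF [[A B] /= [xA xB] AB].
have : nbhs x0 [set x | differentiable F x /\ A x /\ B x].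
  exact: filterI dF (filterI xA xB).
move=> /nbhs_dist_leP [e e0 He].
exists e => // x y xe ye; set u := y - x.
have yE : y = x + u by rewrite /u addrC subrK.
rewrite yE; rewrite yE in ye.
apply: segment_increment_le => s s01; have se := segment_in_ball xe ye s01.
  by case: (He _ se).
have [_ [As _]] := He _ se; have [_ [_ Bx]] := He _ xe.
apply: (le_trans (AB (_, _) (conj As Bx) u)) => /=.
have -> : x + s *: u - x = s *: u by rewrite (addrC x) addrK.
have su : `|s *: u| `^ theta <= `|u| `^ theta.
  apply: ge0_ler_powR; [exact: theta0 | exact: normr_ge0 | exact: normr_ge0 |].
  by move/andP: s01 => [s0 s1]; rewrite normrZ ler_piMl ?normr_ge0 ?ger0_norm.
apply: ler_wpM2r; first exact: normr_ge0.
apply: (le_trans (ler_wpM2r (powR_ge0 _ _) (ler_norm C))).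
exact: ler_wpM2l (normr_ge0 C) _ _ su.
Qed.

End LocalCalculus.

Section Charts.
Context {R : realType} {d : nat} {M : topologicalType}.
Implicit Types (c : chart R d M) (p : M).

Lemma cod_coord c p : dom c p -> cod c (coord c p).
Proof. by exists p. Qed.

Lemma invP c x : cod c x -> dom c (inv c x) /\ coord c (inv c x) = x.
Proof. by move=> [p cp <-]; rewrite coordK. Qed.

Lemma coord_inj c p q : dom c p -> dom c q -> coord c p = coord c q -> p = q.
Proof. by move=> cp cq E; rewrite -(coordK cp) E coordK. Qed.

Lemma nbhs_dom c p : dom c p -> nbhs p (dom c).
Proof. by move=> cp; apply: open_nbhs_nbhs; split => //; exact: dom_open. Qed.

Lemma nbhs_cod c x : cod c x -> nbhs x (cod c).
Proof. by move=> cx; apply: open_nbhs_nbhs; split => //; exact: cod_open. Qed.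

Lemma nbhs_inv c p V : dom c p -> nbhs p V ->
  \forall x \near coord c p, cod c x /\ V (inv c x).
Proof.
move=> cp pV; apply: filterI; first exact: nbhs_cod (cod_coord cp).
by have := @inv_continuous _ _ _ c _ (cod_coord cp) V; rewrite coordK //; exact.
Qed.

Lemma nbhs_rep_dom (f : M -> M) c c' p : {for p, continuous f} ->
  dom c p -> dom c' (f p) -> \forall x \near coord c p, rep_dom f c c' x.
Proof.
move=> fp cp cfp.
have := nbhs_inv cp (fp _ (nbhs_dom cfp)).
apply: filterS => x [cx fx]; exists (inv c x); last by case: (invP cx).
by split => //; case: (invP cx).
Qed.

Lemma rep_dom_coord (f : M -> M) c c' p : dom c p ->
  rep_dom f c c' (coord c p) -> dom c' (f p).
Proof. by move=> cp [q [cq fq]] /(coord_inj cq cp) <-. Qed.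

Lemma local_rep_coord (f : M -> M) c c' p : dom c p ->
  local_rep f c c' (coord c p) = coord c' (f p).
Proof. by move=> cp; rewrite /local_rep coordK. Qed.

Lemma near_coord c p (e : R) : dom c p -> 0 < e ->
  \forall q \near p, `|coord c q - coord c p| <= e.
Proof.
move=> cp e0; have H : \forall x \near coord c p, `|x - coord c p| <= e.
  by apply/nbhs_dist_leP; exists e.
exact: (coord_continuous cp H).
Qed.

End Charts.

(** * The distance of a chart selection *)

Section Distance.
Context {R : realType} {d : nat} {M : topologicalType}.
Context (X : smooth_manifold R d M) (g : riemannian_metric X).
Context (M_compact : compact [set: M]).
Implicit Types (c : chart R d M) (p q : M).

Lemma tnorm_gram c x v : tnorm g c x v = gram_norm (gram g c x) v.
Proof. by []. Qed.

Lemma tnorm_gt0 c x v : atlas X c -> cod c x -> v != 0 -> 0 < tnorm g c x v.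
Proof.
by move=> Xc cx v0; apply: gram_norm_gt0 => // w w0; exact: gram_pos.
Qed.

Lemma tnorm_comparable c p : atlas X c -> dom c p ->
  exists2 k : R, 0 < k & \forall q \near p, dom c q /\ forall v,
    k * `|v| <= tnorm g c (coord c q) v /\ tnorm g c (coord c q) v <= k^-1 * `|v|.
Proof.
move=> Xc cp; have cx := cod_coord cp.
have [|w w0|k k0 H] := @gram_norm_comparable _ _ (gram g c) (coord c p).
- by have /= := gram_smooth g Xc 0%N; apply.
- exact: gram_pos.
- exists k => //; apply: filterI; first exact: nbhs_dom.
  exact: (coord_continuous cp H).
Qed.

(* Junk value 1 off the domain of the chart: distances are only compared to
   numbers smaller than 1. *)
Definition chart_dist c p q : R :=
  if `[< dom c q >] then tnorm g c (coord c p) (coord c q - coord c p) else 1.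

Lemma chart_distE c p q : dom c q ->
  chart_dist c p q = tnorm g c (coord c p) (coord c q - coord c p).
Proof. by move=> cq; rewrite /chart_dist asboolT. Qed.

Lemma chart_dist_dom c p q : chart_dist c p q < 1 -> dom c q.
Proof. by rewrite /chart_dist; case: asboolP => //; rewrite ltxx. Qed.

Lemma chart_dist_ge0 c p q : 0 <= chart_dist c p q.
Proof. by rewrite /chart_dist; case: asboolP => // _; exact: gram_norm_ge0. Qed.

Lemma chart_dist_xx c p : dom c p -> chart_dist c p p = 0.
Proof. by move=> cp; rewrite chart_distE // subrr tnorm_gram gram_norm0. Qed.

Lemma chart_dist_gt0 c p q : atlas X c -> dom c p -> p != q ->
  0 < chart_dist c p q.
Proof.
move=> Xc cp pq; rewrite /chart_dist; case: asboolP => // cq.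
apply: tnorm_gt0 => //; first exact: cod_coord.
rewrite subr_eq0; apply: contra_neq pq => /esym; exact: coord_inj.
Qed.

Lemma transition_lipschitz c c' p : atlas X c -> atlas X c' ->
  dom c p -> dom c' p ->
  exists2 K : R, 0 < K & exists2 e : R, 0 < e & forall q q', dom c q -> dom c q' ->
    `|coord c q - coord c p| <= e -> `|coord c q' - coord c p| <= e ->
    [/\ dom c' q, dom c' q' &
       `|coord c' q' - coord c' q| <= K * `|coord c q' - coord c q|].
Proof.
move=> Xc Xc' cp cp'.
have [/(_ 1%N) [dF cF] _] := atlas_compatible Xc Xc'.
have repx : \forall x \near coord c p, rep_dom id c c' x.
  by apply: nbhs_rep_dom => //; exact: cvg_id.
have [||K [e [K0 e0 He]]] := @locally_lipschitz _ _ _ (local_rep id c c') (coord c p).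
- by apply: filterS repx => x; exact: dF.
- move=> v; apply: cF; exact: nbhs_singleton repx.
have /nbhs_dist_leP [e' e'0 He'] := repx.
exists K => //; exists (Num.min e e'); first by rewrite lt_min e0.
move=> q q' cq cq'; rewrite !le_min => /andP[qe qe'] /andP[q'e q'e'].
have c'q := rep_dom_coord cq (He' _ qe').
have c'q' := rep_dom_coord cq' (He' _ q'e').
by split=> //; have := He _ _ qe q'e; rewrite !local_rep_coord.
Qed.

(** The selected chart need not vary continuously. The last clause allows one to argue as if it were
    fixed: what holds locally in every chart around [h x] holds, with uniform constants, in the
    chart selected at [h y]. It is used for [h = id] and [h = f]. *)
Definition chart_selection (ch : M -> chart R d M) : Prop :=
  [/\ forall p, atlas X (ch p), forall p, dom (ch p) p &
    forall (T : topologicalType) (h : T -> M) (x : T)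
      (A : R -> T -> chart R d M -> Prop), {for x, continuous h} ->
      (forall c, atlas X c -> dom c (h x) -> locally_small x (fun t y => A t y c)) ->
      locally_small x (fun t y => A t y (ch (h y)))].

(** Each selected chart comes with a piece whose closure lies in its domain. A chart selected at
    points arbitrarily near [h x] thus has [h x] in its domain, and only finitely many charts
    occur. *)
Lemma exists_chart_selection : exists ch, chart_selection ch.
Proof.
have H p : exists cV : chart R d M * set M,
    [/\ atlas X cV.1, nbhs p cV.2 & closure cV.2 `<=` dom cV.1].
  have [c Xc cp] := atlas_cover X p.
  have [V pV Vc] := compact_regular (manifold_hausdorff X) M_compact
    (@filterT _ (nbhs p) _) (nbhs_dom cp).
  by exists (c, V).
have /choice [cV cVP] := H.
(* a finite subcover, by compactness along the filter of the large finite sets *)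
pose F : set_system (seq M) :=
  [set S : set (seq M) | exists s0 : seq M,
    forall s : seq M, {subset s0 <= s} -> S s].
have FF : Filter F.
  split.
  - by exists [::].
  - move=> S S' [s0 Ss0] [s1 Ss1]; exists (s0 ++ s1) => s sub; split.
      by apply: Ss0 => x xs; apply: sub; rewrite mem_cat xs.
    by apply: Ss1 => x xs; apply: sub; rewrite mem_cat xs orbT.
  - by move=> S S' SS' [s0 Ss0]; exists s0 => s /Ss0 /SS'.
have [s0 Hs0] : \near F, [set: M] `<=` (fun p => exists2 i, i \in F & (cV i).2 p).
  apply: ((compact_near_coveringP [set: M]).1 M_compact _ F
    (fun (s : seq M) p => exists2 i, i \in s & (cV i).2 p) FF) => p _.
  have [_ pV _] := cVP p.
  exists ((cV p).2, [set s : seq M | p \in s]) => /=.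
    by split=> //; exists [:: p] => s; apply; rewrite mem_head.
  by case=> q s /= [Vq ps]; exists p.
have /choice [idx idxP] : forall p, exists i, i \in s0 /\ (cV i).2 p.
  by move=> p; have [i] := Hs0 s0 (fun x xs => xs) p I; exists i.
exists (fun p => (cV (idx p)).1); split.
- by move=> p; have [] := cVP (idx p).
- move=> p; have [_ _] := cVP (idx p); apply; apply: subset_closure.
  by case: (idxP p).
- move=> T h x A hx HA.
  have H1 i : i \in s0 -> locally_small x (fun t y => (cV i).2 (h y) -> A t y (cV i).1).
    move=> _; have [Xi _ Vi] := cVP i.
    have [cl|ncl] := pselect (closure (cV i).2 (h x)).
      by exact: (locally_smallS (fun t y H _ => H) (HA _ Xi (Vi _ cl))).
    have nb : nbhs (h x) (~` closure (cV i).2).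
      by apply: open_nbhs_nbhs; split => //; apply: closed_openC; exact: closed_closure.
    have xnb : nbhs x (h @^-1` ~` closure (cV i).2) by exact: hx nb.
    apply: (locally_smallS _ (locally_small_nbhs (R := R) xnb)) => t y ny Vy.
    by exfalso; apply: ny; exact: subset_closure.
  apply: (locally_smallS _ (locally_small_seq H1)) => t y Hy.
  by have [is0 Vi] := idxP (h y); exact: Hy.
Qed.

Context (ch : M -> chart R d M) (chP : chart_selection ch).

Definition dist p q : R := chart_dist (ch p) p q.

Lemma dist_ge0 p q : 0 <= dist p q. Proof. exact: chart_dist_ge0. Qed.

Lemma dist_xx p : dist p p = 0.
Proof. by apply: chart_dist_xx; case: chP. Qed.

Lemma dist_gt0 p q : p != q -> 0 < dist p q.
Proof. by apply: chart_dist_gt0; case: chP. Qed.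

Lemma dist_bilipschitz c p0 : atlas X c -> dom c p0 ->
  exists V : set M, exists K : R, [/\ nbhs p0 V, 0 < K & forall p q, V p -> V q ->
    [/\ dom c p, dom c q, `|coord c q - coord c p| <= K * dist p q &
        dist p q <= K * `|coord c q - coord c p|]].
Proof.
move=> Xc cp0.
have [_ _ chls] := chP.
have [||V [t0 [p0V t00 H]]] := chls M id p0 (fun t p c' => forall q, dom c q -> dom c p ->
     `|coord c q - coord c p0| <= t -> `|coord c p - coord c p0| <= t ->
     t * `|coord c q - coord c p| <= chart_dist c' p q /\
     t * chart_dist c' p q <= `|coord c q - coord c p|) _ _.
- exact: cvg_id.
- move=> c' Xc' cp0' /=.
  have [K K0 [e e0 HK]] := transition_lipschitz Xc Xc' cp0 cp0'.
  have [K' K'0 [e' e'0 HK']] := transition_lipschitz Xc' Xc cp0' cp0.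
  have [k k0 Hk] := tnorm_comparable Xc' cp0'.
  exists ([set q | dom c' q /\ (forall v, k * `|v| <= tnorm g c' (coord c' q) v /\
    tnorm g c' (coord c' q) v <= k^-1 * `|v|)]).
  (* The first two bounds keep the points where both coordinate changes are Lipschitz; the last two
     absorb the constants of the two inequalities. *)
  exists (Num.min (Num.min e (e' / K)) (Num.min (k / K') (k / K))); split=> //.
    by rewrite !lt_min e0 !divr_gt0.
  move=> p t [c'p Np] t_gt0; rewrite !le_min => /andP[/andP[te te'] /andP[tk tk']].
  move=> q cq cp qt pt.
  have pe := le_trans pt te; have qe := le_trans qt te.
  have [_ c'q L] := HK p q cp cq pe qe.
  have p0e : `|coord c p0 - coord c p0| <= e by rewrite subrr normr0 ltW.
  have e'P z : dom c z -> `|coord c z - coord c p0| <= t -> `|coord c' z - coord c' p0| <= e'.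
    move=> cz zt; have [_ _ /le_trans->//] := HK p0 z cp0 cz p0e (le_trans zt te).
    by rewrite mulrC -ler_pdivlMr // (le_trans zt).
  have [_ _ L'] := HK' p q c'p c'q (e'P _ cp pt) (e'P _ cq qt).
  rewrite chart_distE //; have [N1 N2] := Np (coord c' q - coord c' p).
  move: L L' N1 N2; set a := `|coord c' q - _|; set b := `|coord c q - _|.
  set N := tnorm _ _ _ _ => L L' N1 N2.
  have b0 : 0 <= b by exact: normr_ge0.
  split.
    apply: le_trans N1; apply: (le_trans (y := k / K' * b)); first by rewrite ler_wpM2r.
    by rewrite -mulrA ler_pM2l // mulrC ler_pdivrMr // mulrC.
  apply: (le_trans (y := k / K * (k^-1 * a))).
    by apply: ler_pM => //; [exact: ltW | exact: gram_norm_ge0].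
  rewrite [leLHS](_ : _ = a / K); last by field; rewrite !gt_eqF.
  by rewrite ler_pdivrMr // mulrC.
exists (V `&` [set q | dom c q /\ `|coord c q - coord c p0| <= t0]), t0^-1.
split; rewrite ?invr_gt0 //.
  apply: filterI => //; apply: filterI; first exact: nbhs_dom.
  exact: near_coord.
move=> p q [Vp [cp pt]] [Vq [cq qt]].
have [h1 h2] := H p t0 Vp t00 (lexx _) q cq cp qt pt.
split => //; first by rewrite mulrC ler_pdivlMr // mulrC.
by rewrite mulrC ler_pdivlMr // mulrC.
Qed.

Lemma dist_nbhs p0 (V : set M) : nbhs p0 V -> exists2 e : R, 0 < e &
  \forall p \near p0, forall q, dist p q <= e -> V q.
Proof.
move=> p0V; have [_ _ chls] := chP.
have [||W [t0 [p0W t00 H]]] := chls M id p0 (fun t p c => forall q,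
    chart_dist c p q <= t -> V q) _ _.
- exact: cvg_id.
- move=> c Xc cp0 /=.
  have [k k0 Hk] := tnorm_comparable Xc cp0.
  have /nbhs_dist_leP [e e0 He] := nbhs_inv cp0 p0V.
  have near_e := near_coord cp0 (divr_gt0 e0 (ltr0n R 2 : 0 < 2 :> R)).
  exists ([set q | dom c q /\ (forall v, k * `|v| <= tnorm g c (coord c q) v /\
    tnorm g c (coord c q) v <= k^-1 * `|v|)] `&`
    [set q | `|coord c q - coord c p0| <= e / 2]).
  (* Being below the junk value 1, the bound [1 / 2] puts [q] in the chart; the other bound keeps
     its coordinates within [e / 2] of those of [p]. *)
  exists (Num.min (1 / 2) (k * (e / 2))); split; first exact: filterI.
    by rewrite lt_min divr_gt0 //= mulr_gt0 // divr_gt0.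
  move=> p t [[cp Np] pe] t_gt0; rewrite le_min => /andP[t1 tk] q qt.
  have cq : dom c q by apply: (@chart_dist_dom c p); lra.
  move: qt; rewrite chart_distE // => qt.
  have [N1 _] := Np (coord c q - coord c p).
  have qp : `|coord c q - coord c p| <= e / 2.
    by rewrite -(ler_pM2l k0) (le_trans N1) // (le_trans qt).
  have [_] : cod c (coord c q) /\ V (inv c (coord c q)).
    apply: He; have := ler_distD (coord c p) (coord c q) (coord c p0).
    by rewrite /= in pe; lra.
  by rewrite coordK.
exists t0 => //; apply: filterS p0W => p Wp q; exact: (H p t0 Wp t00 (lexx _)).
Qed.

Lemma dist_small p0 (e : R) : 0 < e ->
  exists2 V : set M, nbhs p0 V & forall p q, V p -> V q -> dist p q <= e.
Proof.
move=> e0; have [ch1 ch2 _] := chP.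
have [V [K [p0V K0 VK]]] := dist_bilipschitz (ch1 p0) (ch2 p0).
have eK : 0 < e / K / 2 by rewrite !divr_gt0.
exists (V `&` [set q | `|coord (ch p0) q - coord (ch p0) p0| <= e / K / 2]).
  by apply: filterI => //; exact: near_coord.
move=> p q [Vp pe] [Vq qe]; have [_ _ _ /le_trans] := VK p q Vp Vq; apply.
rewrite mulrC -ler_pdivlMr //.
have := ler_distD (coord (ch p0) p0) (coord (ch p0) q) (coord (ch p0) p).
rewrite (distrC (coord (ch p0) p0)); rewrite /= in pe qe.
by move: pe qe; set w := e / K; lra.
Qed.

(** In a fixed chart, both distances are comparable to the coordinate distance, which is
    symmetric. *)
Lemma dist_quasi_sym : exists K e : R, [/\ 0 < K, 0 < e &
  forall p q, dist p q <= e -> dist q p <= K * dist p q].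
Proof.
have [ch1 ch2 _] := chP.
have [|t t0 H] := compact_locally_small
  (A := fun t p => forall q, dist p q <= t -> dist q p <= t^-1 * dist p q) M_compact.
  move=> p0 _.
  have [V [K [p0V K0 VK]]] := dist_bilipschitz (ch1 p0) (ch2 p0).
  have [e e0 He] := dist_nbhs p0V.
  exists (V `&` [set p | forall q, dist p q <= e -> V q]), (Num.min e (K * K)^-1).
  split; first exact: filterI.
    by rewrite lt_min e0 invr_gt0 mulr_gt0.
  move=> p t [Vp Hp] t_gt0; rewrite le_min => /andP[te tK] q qt.
  have Vq := Hp q (le_trans qt te).
  have [_ _ a _] := VK p q Vp Vq; have [_ _ _ b] := VK q p Vq Vp.
  apply: (le_trans b); rewrite distrC.
  apply: (le_trans (y := K * (K * dist p q))); first by rewrite ler_pM2l.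
  rewrite mulrA ler_wpM2r ?dist_ge0 //.
  by rewrite -[leLHS]invrK lef_pV2 ?posrE ?invr_gt0 ?mulr_gt0.
exists t^-1, t; split => //; first by rewrite invr_gt0.
by move=> p q; exact: H.
Qed.

Lemma dist_inv_bilipschitz c (Q : set 'rV[R]_d) : atlas X c -> compact Q ->
  Q `<=` cod c -> exists K e : R, [/\ 0 < K, 0 < e &
    forall x x', Q x -> Q x' -> `|x - x'| <= e ->
      `|x - x'| <= K * dist (inv c x) (inv c x') /\
      dist (inv c x) (inv c x') <= K * `|x - x'|].
Proof.
move=> Xc Qcompact Qc.
have [|t t0 H] := compact_locally_small
  (A := fun t x => forall x', Q x -> Q x' -> `|x - x'| <= t ->
     `|x - x'| <= t^-1 * dist (inv c x) (inv c x') /\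
      dist (inv c x) (inv c x') <= t^-1 * `|x - x'|) Qcompact.
  move=> x0 Qx0; have [cx0 x0E] := invP (Qc _ Qx0).
  have [V [K [p0V K0 VK]]] := dist_bilipschitz Xc cx0.
  have := nbhs_inv cx0 p0V; rewrite x0E => /nbhs_dist_leP [e e0 He].
  have e2 : 0 < e / 2 by rewrite divr_gt0.
  exists [set x | `|x - x0| <= e / 2], (Num.min (e / 2) K^-1); split.
  - by apply/nbhs_dist_leP; exists (e / 2).
  - by rewrite lt_min e2 invr_gt0.
  move=> x t xe t_gt0; rewrite le_min => /andP[te tK] x' Qx Qx' xt.
  rewrite /= in xe.
  have [_ Vx] : cod c x /\ V (inv c x) by apply: He; lra.
  have [_ Vx'] : cod c x' /\ V (inv c x').
    by apply: He; have := ler_distD x x' x0; rewrite (distrC x' x); lra.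
  have [_ _] := VK _ _ Vx Vx'.
  have [_ ->] := invP (Qc _ Qx); have [_ ->] := invP (Qc _ Qx').
  rewrite distrC => a b.
  have Kt : K <= t^-1 by rewrite -[leLHS]invrK lef_pV2 ?posrE ?invr_gt0.
  split; first by rewrite (le_trans a) // ler_wpM2r ?dist_ge0.
  by rewrite (le_trans b) // ler_wpM2r.
exists t^-1, t; split => //; first by rewrite invr_gt0.
by move=> x x' Qx; exact: H.
Qed.

End Distance.

(** * Conformal expanding maps *)

Section ConformalMaps.
Context {R : realType} {d : nat} {M : topologicalType}.
Context (X : smooth_manifold R d M) (g : riemannian_metric X).
Implicit Types (c : chart R d M) (p q : M) (f : M -> M).

(** The factor is the absolute value of the given scalar; since [d > 0], it can be compared with
    [sigma] on a nonzero vector. *)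
Lemma conformal_factor f (sigma : R) c c' x : (0 < d)%N -> conformal g f ->
  (forall c c' x v, atlas X c -> atlas X c' -> rep_dom f c c' x ->
    sigma * tnorm g c x v <=
    tnorm g c' (local_rep f c c' x) ('d (local_rep f c c') x v)) ->
  atlas X c -> atlas X c' -> rep_dom f c c' x ->
  exists2 a : R, sigma <= a & forall v,
    tnorm g c' (local_rep f c c' x) ('d (local_rep f c c') x v) =
    a * tnorm g c x v.
Proof.
move=> d0 fconf fexp Xc Xc' rx.
have [a [A [A1 A2]]] := fconf c c' x Xc Xc' rx.
have E v : tnorm g c' (local_rep f c c' x) ('d (local_rep f c c') x v) =
    `|a| * tnorm g c x v.
  by rewrite A2 [LHS]gram_normZ -A1.
exists `|a| => //.
pose v : 'rV[R]_d := delta_mx 0 (Ordinal d0).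
have v0 : v != 0.
  apply/eqP => /rowP /(_ (Ordinal d0)); rewrite !mxE !eqxx => /eqP.
  by rewrite oner_eq0.
have cx : cod c x by case: rx => p [cp _] <-; exact: cod_coord.
by rewrite -(ler_pM2r (tnorm_gt0 g Xc cx v0)) -E fexp.
Qed.

(** Taylor expansion at [p] has a remainder of order [1 + theta]. Conformality evaluates the norm of
    the linear term, and the reverse triangle inequality absorbs the remainder. *)
Lemma conformal_in_charts f (theta sigma : R) c c' p0 : (0 < d)%N -> 0 < theta ->
  C1_holder X theta f -> conformal g f ->
  (forall c c' x v, atlas X c -> atlas X c' -> rep_dom f c c' x ->
    sigma * tnorm g c x v <=
    tnorm g c' (local_rep f c c' x) ('d (local_rep f c c') x v)) ->
  atlas X c -> atlas X c' -> dom c p0 -> dom c' (f p0) ->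
  locally_small p0 (fun t p => exists2 a : R, sigma <= a & forall q,
    chart_dist g c p q <= t ->
    `|chart_dist g c' (f p) (f q) - a * chart_dist g c p q| <=
      t^-1 * chart_dist g c p q `^ theta * chart_dist g c p q).
Proof.
move=> d0 theta0 [fcont fC1] fconf fexp Xc Xc' cp0 c'fp0.
have [/= [dF _] hF] := fC1 c c' Xc Xc'.
have near_rep := nbhs_rep_dom (fcont p0) cp0 c'fp0.
have [C HC] := hF _ (nbhs_singleton near_rep).
have near_dF : \forall x \near coord c p0, differentiable (local_rep f c c') x.
  by apply: filterS near_rep => x; exact: dF.
have [e1 e10 rem] := holder_remainder (ltW theta0) near_dF HC.
have /nbhs_dist_leP [e2 e20 rep] := near_rep.
have [k k0 Hk] := tnorm_comparable g Xc cp0.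
have [k' k'0 Hk'] := tnorm_comparable g Xc' c'fp0.
pose e := Num.min e1 e2.
have e0 : 0 < e by rewrite lt_min e10.
(* Here [k'^-1] passes to the Riemannian norm at [f p], [|C| + 1] bounds the remainder, and the
   powers of [k^-1] replace coordinate norms by Riemannian ones at [p]. *)
pose N0 := k'^-1 * (`|C| + 1) * k^-1 `^ theta * k^-1.
have N00 : 0 < N0.
  by rewrite !mulr_gt0 ?invr_gt0 ?powR_gt0 ?invr_gt0 // ltr_wpDl.
have e2' : 0 < e / 2 by rewrite divr_gt0.
exists ([set q | dom c q /\ forall v,
    k * `|v| <= tnorm g c (coord c q) v /\ tnorm g c (coord c q) v <= k^-1 * `|v|]
  `&` [set q | `|coord c q - coord c p0| <= e / 2]
  `&` f @^-1` [set q | dom c' q /\ forall v,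
    k' * `|v| <= tnorm g c' (coord c' q) v /\
    tnorm g c' (coord c' q) v <= k'^-1 * `|v|]).
exists (Num.min (1 / 2) (Num.min (k * (e / 2)) N0^-1)); split.
- apply: filterI; last exact: (fcont p0 _ Hk').
  by apply: filterI => //; exact: near_coord.
- by rewrite !lt_min divr_gt0 //= invr_gt0 N00 mulr_gt0.
move=> p t [[[cp Np] pe] [c'fp Nfp]] t0; rewrite !le_min => /and3P[t1 tk tN].
rewrite /= in pe.
have inball z : `|z - coord c p| <= e / 2 -> `|z - coord c p0| <= e.
  by move=> zp; have := ler_distD (coord c p) z (coord c p0); lra.
have pball : `|coord c p - coord c p0| <= e.
  by apply: inball; rewrite subrr normr0 ltW.
have le1 z : `|z - coord c p0| <= e -> `|z - coord c p0| <= e1.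
  by move=> /le_trans; apply; rewrite ge_min lexx.
have le2 z : `|z - coord c p0| <= e -> `|z - coord c p0| <= e2.
  by move=> /le_trans; apply; rewrite ge_min lexx orbT.
have rp := rep _ (le2 _ pball).
have [a sa aE] := conformal_factor d0 fconf fexp Xc Xc' rp.
exists a => // q qt.
have cq : dom c q by apply: (@chart_dist_dom _ _ _ _ g c p); lra.
move: qt; rewrite chart_distE //; set u := coord c q - coord c p.
have [N1 _] := Np u.
set n := tnorm g c _ _ in N1 *; move=> nt.
have u_n : `|u| <= k^-1 * n by rewrite -(ler_pM2l k0) mulrA divff ?gt_eqF // mul1r.
have qball : `|coord c q - coord c p0| <= e.
  apply: inball; rewrite -(ler_pM2l k0); apply: le_trans N1 _.
  exact: le_trans nt tk.
have c'fq := rep_dom_coord cq (rep _ (le2 _ qball)).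
have := rem _ _ (le1 _ pball) (le1 _ qball).
have := aE u; rewrite !local_rep_coord // -/u -/n chart_distE //.
move: ('d _ _ u) => L; set y := coord c' (f q); set x := coord c' (f p).
move=> <- err.
have -> : y - x = L + (y - x - L) by rewrite subrKC.
have cfx : cod c' x by exact: cod_coord.
apply: (le_trans (gram_norm_lipschitz L (y - x - L) _ _)).
- exact: gram_sym.
- by move=> w w0; exact: gram_pos.
have [_ Nerr] := Nfp (y - x - L).
apply: (le_trans Nerr).
have n0 : 0 <= n by exact: gram_norm_ge0.
have p1 : `|u| `^ theta <= k^-1 `^ theta * n `^ theta.
  rewrite -powRM ?invr_ge0 ?(ltW k0) //.
  apply: ge0_ler_powR => //; [exact: ltW|exact: normr_ge0|].
  by rewrite nnegrE mulr_ge0 // invr_ge0 ltW.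
apply: (le_trans (y := N0 * n `^ theta * n)); last first.
  apply: ler_wpM2r => //; apply: ler_wpM2r; first exact: powR_ge0.
  by rewrite -[leLHS]invrK lef_pV2 ?posrE ?invr_gt0.
apply: (le_trans (y := k'^-1 *
  ((`|C| + 1) * (k^-1 `^ theta * n `^ theta) * (k^-1 * n)))).
  rewrite ler_pM2l ?invr_gt0 //; apply: (le_trans err).
  apply: ler_pM; [by rewrite mulr_ge0 // powR_ge0 | exact: normr_ge0 | | done].
  apply: ler_pM; [exact: normr_ge0 | exact: powR_ge0 | by rewrite lerDl | done].
by rewrite /N0 le_eqVlt; apply/orP; left; apply/eqP; ring.
Qed.

Lemma dist_conformal (ch : M -> chart R d M) f (theta sigma : R) :
  compact [set: M] -> chart_selection X ch -> (0 < d)%N -> 0 < theta ->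
  C1_holder X theta f -> conformal g f ->
  (forall c c' x v, atlas X c -> atlas X c' -> rep_dom f c c' x ->
    sigma * tnorm g c x v <=
    tnorm g c' (local_rep f c c' x) ('d (local_rep f c c') x v)) ->
  exists2 t : R, 0 < t & exists a : M -> R, forall p, sigma <= a p /\
    forall q, dist g ch p q <= t ->
      `|dist g ch (f p) (f q) - a p * dist g ch p q| <=
        t^-1 * dist g ch p q `^ theta * dist g ch p q.
Proof.
move=> Mcompact [_ _ chls] d0 theta0 fC1 fconf fexp.
have [|t t0 H] := compact_locally_small (A := fun t p => exists2 a : R, sigma <= a &
    forall q, dist g ch p q <= t ->
      `|dist g ch (f p) (f q) - a * dist g ch p q| <=
        t^-1 * dist g ch p q `^ theta * dist g ch p q) Mcompact.
  move=> p0 _; apply: (chls M id p0 (fun t p c => exists2 a : R, sigma <= a &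
    forall q, chart_dist g c p q <= t ->
      `|dist g ch (f p) (f q) - a * chart_dist g c p q| <=
        t^-1 * chart_dist g c p q `^ theta * chart_dist g c p q)).
    exact: cvg_id.
  move=> c Xc cp0.
  (* The chart at [f p] also depends on [p], so the selection property is used again, along [f]. *)
  apply: (chls M f p0 (fun t p c' => exists2 a : R, sigma <= a &
    forall q, chart_dist g c p q <= t ->
      `|chart_dist g c' (f p) (f q) - a * chart_dist g c p q| <=
        t^-1 * chart_dist g c p q `^ theta * chart_dist g c p q)).
    by case: fC1 => fc _; exact: fc.
  by move=> c' Xc' c'fp0; exact: conformal_in_charts.
exists t => //.
have /choice [a aP] : forall p, exists a : R, sigma <= a /\
    forall q, dist g ch p q <= t ->
      `|dist g ch (f p) (f q) - a * dist g ch p q| <=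
        t^-1 * dist g ch p q `^ theta * dist g ch p q.
  by move=> p; have [a] := H p I; exists a.
by exists a.
Qed.

End ConformalMaps.

(** * Winning sets on the manifold and their intersection *)

Section EscapingSets.
Context {R : realType} {d : nat} {M : topologicalType}.
Context (X : smooth_manifold R d M) (g : riemannian_metric X).

Lemma expanding_winning (theta : R) (f : M -> M) c (B : 'rV[R]_d * R) :
  compact [set: M] -> (0 < d)%N -> 0 < theta ->
  expanding_endomorphism g theta f -> conformal g f -> atlas X c ->
  cball B `<=` cod c -> forall y : M,
  (forall k, positional_winning (cball B) [set x | iter k f (inv c x) <> y]) /\
  positional_winning (cball B) [set x | exists2 W, nbhs y W &
    exists k0, forall k, (k0 <= k)%N -> ~ W (iter k f (inv c x))].
Proof.
move=> Mcompact d0 theta0 [fC1 [sigma [sigma2 [sigma1 _ fexp]]]] fconf Xc Bc y.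
have [ch chP] := exists_chart_selection X Mcompact.
have fexp' c1 c2 x v : atlas X c1 -> atlas X c2 -> rep_dom f c1 c2 x ->
    sigma * tnorm g c1 x v <=
    tnorm g c2 (local_rep f c1 c2 x) ('d (local_rep f c1 c2) x v).
  by move=> X1 X2 rx; have [] := fexp c1 c2 x v X1 X2 rx.
have [t t0 [a aP]] := dist_conformal Mcompact chP d0 theta0 fC1 fconf fexp'.
have cont x : cball B x -> {for x, continuous (inv c)}.
  by move=> /Bc cx; exact: inv_continuous.
have inj x x' : cball B x -> cball B x' -> inv c x = inv c x' -> x = x'.
  by move=> /Bc /invP [_ xE] /Bc /invP [_ x'E] E; rewrite -xE -x'E E.
have bilip := dist_inv_bilipschitz g chP Xc (@cball_compact _ _ B) Bc.
have fcont : continuous f by case: fC1.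
have a_ge p := (aP p).1; have conf p := (aP p).2.
have Mh := manifold_hausdorff X.
have Dge0 := @dist_ge0 _ _ _ _ g ch.
have Dxx := dist_xx g chP; have Dgt0 := dist_gt0 g chP.
have Dsmall := dist_small g chP; have Dnbhs := dist_nbhs g chP.
have Dqs := dist_quasi_sym g Mcompact chP.
split=> [k|].
  exact: (iter_neq_winning fcont sigma1 theta0 t0 Dge0 Dxx Dgt0 a_ge conf Dsmall).
exact: (limit_avoids_winning Mcompact Mh fcont sigma1 theta0 t0 Dge0 Dxx Dgt0
  a_ge conf Dsmall Dnbhs Dqs).
Qed.

End EscapingSets.

(** [W] keeps the tail of the orbit away from [y], and the Hausdorff property separates [y] from the
    finitely many earlier points. *)
Lemma E_set_of_avoiding (M : topologicalType) (f : M -> M) (Y : set M) z :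
  hausdorff_space M ->
  (forall y, Y y -> (forall k, iter k f z <> y) /\
    exists2 W, nbhs y W & exists k0, forall k, (k0 <= k)%N -> ~ W (iter k f z)) ->
  E_set f Y z.
Proof.
move=> Mh H; apply/seteqP; split=> // y [Yy cly].
have [neq [W yW [k0 Wk]]] := H y Yy.
have avoid n : nbhs y [set w | forall k, (k < n)%N -> w <> iter k f z].
  elim: n => [|n IH]; first by apply: filterS (@filterT _ (nbhs y) _).
  have : nbhs y (~` [set iter n f z]).
    apply: open_nbhs_nbhs; split; last by move=> /= /esym; exact: neq.
    apply: closed_openC.
    exact: (@accessible_closed_set1 _ (hausdorff_accessible Mh)).
  move=> /(filterI IH); apply: filterS => w [w1 w2] k.
  by rewrite ltnS leq_eqVlt => /orP[/eqP ->|/w1].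
have [_ [[k _ <-] [Wz az]]] := cly _ (filterI yW (avoid k0)).
have [kk0|kk0] := leqP k0 k; first exact: (Wk k).
exact: (az k kk0).
Qed.

Theorem corollary1p3 (R : realType) (d : nat) (M : topologicalType)
  (X : smooth_manifold R d M) (g : riemannian_metric X)
  (M_compact : compact [set: M])
  (theta : R) (theta_gt0 : 0 < theta)
  (f : nat -> M -> M)
  (f_expanding : forall i, expanding_endomorphism g theta (f i))
  (f_conformal : forall i, conformal g (f i))
  (Y : set M) (Y_countable : countable Y) :
  absolute_winning X (\bigcap_i E_set (f i) Y).
Proof.
exists (atlas X); split=> //; first by move=> p; exact: atlas_cover.
move=> c Xc; have [d0|d0] := posnP d; first exact: absolute_winning_on_dim0.
apply: absolute_winning_onI => // B B0 Bc beta beta0 beta1.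
have /countable_injP [code codeP] := Y_countable.
pose target (ik : nat * option nat) y : set 'rV[R]_d :=
  if ik.2 is Some k then [set x | iter k (f ik.1) (inv c x) <> y]
  else [set x | exists2 W, nbhs y W &
    exists k0, forall k, (k0 <= k)%N -> ~ W (iter k (f ik.1) (inv c x))].
(* All conditions form one sequence: [j] encodes a map, a time (or the limit condition) and the code
   of a point of [Y]. Numbers that encode nothing give a trivial game. *)
pose S (j : nat) : set 'rV[R]_d :=
  if unpickle j is Some (ik, m) then
    [set x | forall y, Y y -> code y = m -> target ik y x]
  else setT.
have win j : positional_winning (cball B) (S j).
  rewrite /S; case: (unpickle j) => [[ik m]|]; last exact: positional_winning_setT.
  have [[y [Yy ym]]|noy] := pselect (exists y, Y y /\ code y = m).
    have -> : [set x | forall y, Y y -> code y = m -> target ik y x] = target ik y.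
      apply/seteqP; split=> [x|x xy y' Yy' y'm]; first exact.
      suff -> : y' = y by [].
      by apply: codeP; rewrite ?inE // y'm.
    have [w1 w2] := expanding_winning M_compact d0 theta_gt0 (f_expanding ik.1)
      (f_conformal ik.1) Xc Bc y.
    by rewrite /target; case: ik.2.
  have -> : [set x | forall y, Y y -> code y = m -> target ik y x] = setT.
    by apply/seteqP; split=> // x _ y Yy ym; exfalso; apply: noy; exists y.
  exact: positional_winning_setT.
have [s sP] := positional_winning_bigcap win beta0 beta1.
exists s => b bplay shr x bx.
have [_ b0 _ _] := bplay.
have [cx xE] := invP (Bc _ (b0 _ (bx 0%N I))).
exists (inv c x) => //; split=> // i _.
have Sx := sP b bplay shr x bx.
have T ik y : Y y -> target ik y x.
  move=> Yy; have := Sx (pickle (ik, code y)) I.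
  by rewrite /S pickleK; apply.
apply: E_set_of_avoiding; first exact: manifold_hausdorff X.
move=> y Yy; split; last exact: (T (i, None) y Yy).
by move=> k; exact: (T (i, Some k) y Yy).
Qed.
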